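(* Let $(G_n)_{n\ge 1}$ be a sequence of (possibly random, almost surely finite) graphs such that $|V(G_n)|$ tends to infinity, let $o_n$ be a uniformly chosen vertex of $G_n$, and assume that $(d_{o_n})_{n\ge 1}$ is uniformly integrable. Let $(G,o)$ be a random connected locally finite rooted graph with law $\mu$ such that $\mu(d_o\ge 1)>0$, and assume that $G_n$ converges locally in probability to $(G,o)$. Then $$\rho(G_n)\ \xrightarrow{\ \mathbb{P}\ }\ \frac{3}{\mathbb{E}_\mu[d_o]}\,\mathbb{E}_\mu\big[d_o\,\mathcal{F}^*_\mu(d_o)\,\mathcal{F}^*_\mu(d_V)\big]-3\qquad (n\to\infty),$$ where $V$ is a neighbour of $o$ in $G$ chosen uniformly at random, $\mathcal{F}^*_\mu(k)=F^*_\mu(k)+F^*_\mu(k-1)$ and $$F^*_\mu(k)=\frac{\mathbb{E}_\mu[d_o\mathbf{1}_{\{d_o\le k\}}]}{\mathbb{E}_\mu[d_o]}.$$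
   Context: Graphs are simple and undirected; $d_v$ denotes the degree of vertex $v$. For a graph $G$, $\vec{E}(G)$ is the set of ordered pairs $(u,v)$ with $\{u,v\}\in E(G)$ (each undirected edge gives two directed edges), and $\sum_{u\to v}$ denotes summation over $(u,v)\in\vec{E}(G)$. Local convergence in probability: for a locally finite rooted graph $(G,o)$ and integer $r\ge 0$, $B_r^{(G)}(o)$ is the subgraph of $G$ induced by the vertices at graph distance at most $r$ from $o$, rooted at $o$; $\simeq$ denotes isomorphism of rooted graphs (a graph isomorphism mapping root to root). The sequence $G_n$ converges locally in probability to the random connected rooted graph $(G,o)$ with law $\mu$ if for every rooted graph $H_\star$ and every integer $r\ge 0$, $\frac{1}{|V(G_n)|}\sum_{v\in V(G_n)}\mathbf{1}_{\{B_r^{(G_n)}(v)\simeq H_\star\}}\to\mu(B_r^{(G)}(o)\simeq H_\star)$ in probability as $n\to\infty$. $\mathbb{E}_\mu$ is expectation over $(G,o)\sim\mu$ and over the uniform choice of the neighbour $V$; when $d_o=0$ the integrand containing the factor $d_o$ is $0$. Uniform integrability of $(d_{o_n})$ is with respect to the joint randomness of $G_n$ and $o_n$. Spearman's rho of a finite graph $G$: for integers $k\ge 0$ let $F^*_G(k)=\frac{1}{|\vec{E}(G)|}\sum_{v\in V(G)}d_v\mathbf{1}_{\{d_v\le k\}}$ (with $F^*_G(-1)=0$) and $\mathcal{F}_G(k)=F^*_G(k)+F^*_G(k-1)$. Then $$\rho(G)=\frac{3}{|\vec{E}(G)|}\sum_{u\to v}\mathcal{F}_G(d_u)\mathcal{F}_G(d_v)-3,$$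 with an arbitrary value assigned if $G$ has no edges. *)

(* Defs.v *)
From HB Require Import structures.
From mathcomp Require Import all_boot all_order all_algebra finmap.
From mathcomp Require Import all_classical all_reals all_analysis.

Set Implicit Arguments.
Unset Strict Implicit.
Unset Printing Implicit Defensive.

Import Order.TTheory GRing.Theory Num.Theory.
Import numFieldNormedType.Exports.

Local Open Scope classical_set_scope.
Local Open Scope ring_scope.

(* Vertices are natural numbers; up to isomorphism this covers all finite
   graphs and all connected locally finite graphs, which are countable. *)
Record graph := Graph {
  vert : set nat;
  adj : rel nat;
  adj_sym : symmetric adj;
  adj_irr : irreflexive adj;
  adj_vert : forall u v, adj u v -> vert u }.

Record rgraph := RGraph {
  ugraph :> graph;
  root : nat;
  root_vert : vert ugraph root }.

Definition nbh (G : graph) (v : nat) : set nat := [set u | adj G v u].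

(* The cardinality of a set; it is 0 on infinite sets, because [fset_set] is. *)
Definition scard (T : choiceType) (A : set T) : nat := #|` fset_set A|.

Definition deg (G : graph) (v : nat) : nat := scard (nbh G v).

Definition locally_finite (G : graph) : Prop :=
  forall v, vert G v -> finite_set (nbh G v).

Definition connected_graph (G : graph) : Prop :=
  forall u v, vert G u -> vert G v ->
    exists p : seq nat, path (adj G) u p /\ last u p = v.

Definition dedges (G : graph) : set (nat * nat) := [set e | adj G e.1 e.2].

Definition graph_iso (G H : graph) : Prop :=
  exists f : nat -> nat, set_bij (vert G) (vert H) f /\
    forall u v, vert G u -> vert G v -> adj H (f u) (f v) = adj G u v.

Definition rooted_iso (G : graph) (o : nat) (H : graph) (p : nat) : Prop :=
  exists f : nat -> nat, [/\ set_bij (vert G) (vert H) f,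
    forall u v, vert G u -> vert G v -> adj H (f u) (f v) = adj G u v &
    f o = p].

(* Being at distance at most r from o is being joined to o by a walk with at
   most r edges. *)
Definition ball_vert (G : graph) (o : nat) (r : nat) : set nat :=
  [set v | vert G v /\
    exists p : seq nat, [/\ path (adj G) o p, last o p = v & (size p <= r)%N]].

Section Induced.
Variables (G : graph) (S : set nat).

Let iadj : rel nat := fun u v => [&& adj G u v, u \in S & v \in S].

Lemma iadj_sym : symmetric iadj.
Proof. by move=> u v; rewrite /iadj adj_sym [X in _ && X]andbC. Qed.

Lemma iadj_irr : irreflexive iadj.
Proof. by move=> u; rewrite /iadj adj_irr. Qed.

Lemma iadj_vert u v : iadj u v -> (vert G `&` S) u.
Proof. by case/and3P => /adj_vert Gu /set_mem Su _; split. Qed.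

Definition induced : graph := Graph iadj_sym iadj_irr iadj_vert.
End Induced.

Definition gball (G : graph) (o : nat) (r : nat) : graph :=
  induced G (ball_vert G o r).

Record clrgraph := CLRGraph {
  clr :> rgraph;
  clr_connected : connected_graph clr;
  clr_locally_finite : locally_finite clr }.

Section Point.
Let padj : rel nat := fun _ _ => false.

Lemma padj_sym : symmetric padj. Proof. by []. Qed.
Lemma padj_irr : irreflexive padj. Proof. by []. Qed.
Lemma padj_vert u v : padj u v -> [set 0%N] u. Proof. by []. Qed.

Definition point_graph : graph := Graph padj_sym padj_irr padj_vert.
Definition point_rgraph : rgraph := @RGraph point_graph 0%N erefl.

Lemma point_connected : connected_graph point_rgraph.
Proof. by move=> u v /= -> ->; exists [::]. Qed.

Lemma point_locally_finite : locally_finite point_rgraph.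
Proof.
move=> v _; apply: (@sub_finite_set _ _ set0); last exact: finite_set0.
by move=> u; rewrite /nbh /=.
Qed.

Definition point_clrgraph : clrgraph :=
  CLRGraph point_connected point_locally_finite.
End Point.

HB.instance Definition _ := gen_eqMixin clrgraph.
HB.instance Definition _ := gen_choiceMixin clrgraph.
HB.instance Definition _ := isPointed.Build clrgraph point_clrgraph.

Definition ball_event (r : nat) (H : rgraph) : set clrgraph :=
  [set g : clrgraph | rooted_iso (gball g (root g) r) (root g) H (root H)].

Definition ball_events : set (set clrgraph) :=
  [set A | exists r H, A = ball_event r H].

(* Connected locally finite rooted graphs with the sigma-algebra of the local
   topology (isomorphic rooted graphs are not separated by it). *)
Definition local_space := g_sigma_algebraType ball_events.

(* The mean of f over a uniformly chosen element of A; it is 0 if A is empty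
   or infinite. *)
Definition unif_mean (R : realType) (A : set nat) (f : nat -> R) : R :=
  (\sum_(v \in A) f v) / (scard A)%:R.

(* F(k) + F(k - 1), with F(-1) = 0. *)
Definition midsum (R : realType) (F : nat -> R) (k : nat) : R :=
  F k + (if k is j.+1 then F j else 0).

Section Rho.
Variable R : realType.

Definition Fstar (G : graph) (k : nat) : R :=
  (\sum_(v \in vert G) ((deg G v)%:R * (deg G v <= k)%N%:R : R))
  / (scard (dedges G))%:R.

(* r0 is the arbitrary value assigned to graphs without edges; it is also
   given to infinite graphs, for which rho is not defined. *)
Definition rho (r0 : R) (G : graph) : R :=
  if `[< finite_set (vert G) /\ dedges G !=set0 >] then
    3 / (scard (dedges G))%:R *
      (\sum_(e \in dedges G)
         midsum (Fstar G) (deg G e.1) * midsum (Fstar G) (deg G e.2)) - 3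
  else r0.
End Rho.

Section Law.
Variables (R : realType) (mu : probability local_space R).

Definition root_deg (g : clrgraph) : nat := deg g (root g).

Definition mean_deg : R := \int[mu]_(g in setT) (root_deg g)%:R.

Definition Fstar_mu (k : nat) : R :=
  (\int[mu]_(g in setT) ((root_deg g)%:R * (root_deg g <= k)%N%:R))
  / mean_deg.

(* The inner mean is over the uniform neighbour V of the root. *)
Definition rho_mu : R :=
  3 / mean_deg *
    (\int[mu]_(g in setT) unif_mean (nbh g (root g)) (fun V =>
       (root_deg g)%:R * midsum Fstar_mu (root_deg g)
                       * midsum Fstar_mu (deg g V))) - 3.
End Law.

(* Measurability of a random finite graph, up to isomorphism. *)
Definition measurable_graph (d : measure_display) (Om : measurableType d)
    (G : Om -> graph) : Prop :=
  forall H : graph, finite_set (vert H) ->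
    measurable [set w | graph_iso (G w) H].

Section Sequences.
Variables (R : realType) (d : nat -> measure_display).
Variables (Om : forall n, measurableType (d n)).
Variables (P : forall n, probability (Om n) R).

Definition cvg_in_probability (X : forall n, Om n -> R) (c : R) : Prop :=
  forall eps : R, 0 < eps ->
    P n [set w | eps < `|X n w - c|] @[n --> \oo] --> 0%E.

Variable G : forall n, Om n -> graph.

Definition size_to_infinity : Prop :=
  forall K : nat,
    P n [set w | (scard (vert (G w)) <= K)%N] @[n --> \oo] --> 0%E.

(* The integral is E[d_{o_n} 1_{d_{o_n} > K}], the inner mean being over the
   uniform vertex o_n of G_n. *)
Definition unif_integrable_deg : Prop :=
  forall eps : R, 0 < eps -> exists K : nat, forall n,
    (\int[P n]_(w in setT) (unif_mean (vert (G w)) (fun o =>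
       (deg (G w) o)%:R * (K < deg (G w) o)%N%:R))%:E <= eps%:E)%E.

Definition ball_freq (H : rgraph) (r : nat) (K : graph) : R :=
  unif_mean (vert K) (fun v =>
    (`[< rooted_iso (gball K v r) v H (root H) >])%:R).

Definition cvg_locally_in_probability (mu : probability local_space R) : Prop :=
  forall (H : rgraph) (r : nat),
    cvg_in_probability (fun n w => ball_freq H r (@G n w))
      (fine (mu (ball_event r H))).
End Sequences.

(* Main.v *)
Require Import Defs.
From mathcomp Require Import finmap.
From mathcomp Require Import all_boot all_order all_algebra.
From mathcomp Require Import all_classical all_reals all_analysis measurable_realfun.
From mathcomp Require Import lra.

Set Implicit Arguments.
Unset Strict Implicit.
Unset Printing Implicit Defensive.

Import Order.TTheory GRing.Theory Num.Theory.
Import numFieldNormedType.Exports.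

Local Open Scope classical_set_scope.
Local Open Scope ring_scope.

(* The root-neighbourhood functionals that enter rho depend only on the
   isomorphism class of the 2-ball, and there are countably many such classes.
   Local convergence gives convergence in probability of each class frequency,
   hence (Scheffe) of the mean of every bounded functional; truncating at a
   large degree and using uniform integrability extends this to functionals
   bounded by a multiple of the degree.  Dividing numerator and denominator by
   |V(G_n)|, rho is 3 T / A - 3 with A the mean degree and T the mean over v of
   the sum, over the neighbours u of v, of the product of F_n(k) + F_n(k - 1) at
   k = d_v and at k = d_u, where F_n is the size-biased degree distribution
   function.  The random F_n can be replaced by its limit because it converges
   pointwise to a distribution function, and then uniformly since both are
   monotone; what remains is the mean of a fixed functional. *)

(** * Means over finite sets *)

Lemma fset_set_infinite (T : choiceType) (A : set T) :
  ~ finite_set A -> fset_set A = fset0.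
Proof. by rewrite /fset_set; case: pselect. Qed.

Section UnifMean.
Variable R : realType.
Implicit Types (A B : set nat) (f g : nat -> R).

(** An infinite set has the empty [fset_set] and cardinality 0, and division by 0 gives 0, so the
    list form holds without a finiteness hypothesis. *)
Lemma unif_meanE A f : unif_mean A f =
  (\sum_(v <- fset_set A) f v) / (scard A)%:R.
Proof.
rewrite /unif_mean /scard; have [fA|iA] := pselect (finite_set A).
  by rewrite fsbig_finite.
by rewrite fset_set_infinite// !cardfs0 invr0 !mulr0.
Qed.

Lemma le_unif_mean A f g : (forall v, A v -> f v <= g v) ->
  unif_mean A f <= unif_mean A g.
Proof.
move=> fg; rewrite !unif_meanE ler_wpM2r// ?invr_ge0//.
have [fA|iA] := pselect (finite_set A); last first.
  by rewrite fset_set_infinite// !big_seq_fset0.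
by rewrite big_seq [leRHS]big_seq; apply: ler_sum => v; rewrite in_fset_set// inE => /fg.
Qed.

Lemma eq_unif_mean A f g : (forall v, A v -> f v = g v) ->
  unif_mean A f = unif_mean A g.
Proof. by move=> fg; apply/le_anti/andP; split; apply: le_unif_mean => v /fg ->. Qed.

Lemma unif_meanD A f g :
  unif_mean A (fun v => f v + g v) = unif_mean A f + unif_mean A g.
Proof. by rewrite !unif_meanE big_split mulrDl. Qed.

Lemma unif_meanZ A c f : unif_mean A (fun v => c * f v) = c * unif_mean A f.
Proof. by rewrite !unif_meanE -mulr_sumr mulrA. Qed.

Lemma unif_meanB A f g :
  unif_mean A (fun v => f v - g v) = unif_mean A f - unif_mean A g.
Proof.
rewrite -[- unif_mean A g]mulN1r -unif_meanZ -unif_meanD.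
by apply: eq_unif_mean => v _; rewrite mulN1r.
Qed.

Lemma unif_mean_sum A n (f : nat -> nat -> R) :
  unif_mean A (fun v => \sum_(i < n) f i v) = \sum_(i < n) unif_mean A (f i).
Proof.
under [RHS]eq_bigr do rewrite unif_meanE.
by rewrite unif_meanE exchange_big mulr_suml.
Qed.

Lemma unif_mean0 A : unif_mean A (fun=> 0) = 0 :> R.
Proof. by rewrite unif_meanE big1 ?mul0r. Qed.

Lemma unif_mean_ge0 A f : (forall v, A v -> 0 <= f v) -> 0 <= unif_mean A f.
Proof. by move=> f0; rewrite -(unif_mean0 A); apply: le_unif_mean. Qed.

Lemma unif_mean1 A : scard A != 0%N -> unif_mean A (fun=> 1) = 1 :> R.
Proof.
move=> A0; rewrite unif_meanE big_const_seq count_predT -/(scard A).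
by rewrite iter_addr_0 -[1 *+ _]/((scard A)%:R : R) divff// pnatr_eq0.
Qed.

Lemma ler_norm_unif_mean A f : `|unif_mean A f| <= unif_mean A (fun v => `|f v|).
Proof.
rewrite !unif_meanE normrM normfV [X in _ / X]ger0_norm//.
by rewrite ler_wpM2r ?invr_ge0// ler_norm_sum.
Qed.

Lemma sum1_scard (T : choiceType) (A : set T) : finite_set A ->
  \sum_(v \in A) (1 : R) = (scard A)%:R.
Proof.
move=> fA; rewrite fsbig_finite//= big_const_seq count_predT.
by rewrite iter_addr_0.
Qed.

End UnifMean.

Lemma scard_infinite (T : choiceType) (A : set T) : ~ finite_set A -> scard A = 0%N.
Proof. by move=> iA; rewrite /scard fset_set_infinite// cardfs0. Qed.

Lemma scard_eq0 (T : choiceType) (A : set T) : finite_set A ->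
  (scard A == 0%N) = (A == set0).
Proof.
move=> fA; rewrite /scard cardfs_eq0; apply/eqP/eqP => [|->]; last exact: fset_set0.
exact: fset_set_set0.
Qed.

Lemma set_bij_image (T U : Type) (A : set T) (B : set U) (f : T -> U) :
  set_bij A B f -> f @` A = B.
Proof. by move=> [fAB _ fs]; apply: surj_image_eq => // _ [x Ax <-]; exact: fAB. Qed.

(** Infinite sets are covered too: a bijection preserves infiniteness, and then both cardinalities
    take the default value 0. *)
Lemma scard_bij (T U : pointedType) (A : set T) (B : set U) (f : T -> U) :
  set_bij A B f -> scard A = scard B.
Proof.
move=> fAB; have [fA|iA] := pselect (finite_set A).
  rewrite /scard -(set_bij_image fAB) fset_set_image// card_in_imfset//= => x y.
  by rewrite !in_fset_set//; case: fAB => _ + _; apply.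
rewrite !scard_infinite// => /(finite_image (pinv A f)).
by rewrite (set_bij_image (bijpinv_bij _ fAB)).
Qed.

Lemma unif_mean_bij (R : realType) (A B : set nat) (f : nat -> nat) (F G : nat -> R) :
  set_bij A B f -> (forall v, A v -> F v = G (f v)) ->
  unif_mean A F = unif_mean B G.
Proof.
move=> fAB FG; rewrite /unif_mean (scard_bij fAB); congr (_ / _).
rewrite (reindex_fsbig f A B)//; apply: eq_fsbigr => v /set_mem; exact: FG.
Qed.

Lemma set_bij_inv (T U : pointedType) (A : set T) (B : set U) f : set_bij A B f ->
  exists g, [/\ set_bij B A g, forall x, A x -> g (f x) = x &
              forall y, B y -> f (g y) = y].
Proof.
move=> fAB; exists (pinv A f); split; first exact: bijpinv_bij.
- by case: fAB => _ fi _ x Ax; rewrite pinvKV ?inE.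
- by move=> y By; rewrite pinvK// (set_bij_image fAB) inE.
Qed.

(** * Isomorphisms, balls and codes of finite graphs *)

Definition is_iso (f : nat -> nat) (G H : graph) : Prop :=
  set_bij (vert G) (vert H) f /\
  forall u v, vert G u -> vert G v -> adj H (f u) (f v) = adj G u v.

Lemma adj_vertr G u v : adj G u v -> vert G v.
Proof. by rewrite adj_sym => /adj_vert. Qed.

Lemma is_iso_comp f g G H K : is_iso f G H -> is_iso g H K -> is_iso (g \o f) G K.
Proof.
move=> [fb fa] [gb ga]; split; first exact: set_bij_comp fb gb.
by move=> u v Gu Gv; case: fb => fh _ _; rewrite ga ?fa//; exact: fh.
Qed.

Lemma is_iso_inv f G H : is_iso f G H ->
  exists g, is_iso g H G /\ forall x, vert G x -> g (f x) = x.
Proof.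
move=> [fb fa]; have [g [gb gf fg]] := set_bij_inv fb.
exists g; split=> //; split=> // u v Hu Hv.
by case: gb => gh _ _; rewrite -fa ?fg//; exact: gh.
Qed.

Lemma rooted_iso_sym G o H p : vert G o -> rooted_iso G o H p -> rooted_iso H p G o.
Proof.
move=> Go [f [fb fa fo]]; have [g [[gb ga] gf]] := is_iso_inv (conj fb fa).
by exists g; split => //; rewrite -fo gf.
Qed.

Lemma rooted_iso_trans G o H p K q :
  rooted_iso G o H p -> rooted_iso H p K q -> rooted_iso G o K q.
Proof.
move=> [f [fb fa fo]] [g [gb ga gp]].
have [hb ha] := is_iso_comp (conj fb fa) (conj gb ga).
by exists (g \o f); split => //=; rewrite fo.
Qed.

Lemma is_iso_nbh f G H v : is_iso f G H -> vert G v ->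
  set_bij (nbh G v) (nbh H (f v)) f.
Proof.
move=> [[fh fi fs] fa] Gv; split.
- by move=> u /= vu; rewrite /nbh/= fa//; exact: adj_vertr vu.
- move=> x y /set_mem/= vx /set_mem/= vy; apply: fi; rewrite inE; [exact: adj_vertr vx|exact: adj_vertr vy].
- move=> w /= vw; have [x Gx fx] := fs _ (adj_vertr vw).
  by exists x => //; rewrite /nbh /= -fa// fx.
Qed.

Lemma is_iso_deg f G H v : is_iso f G H -> vert G v -> deg H (f v) = deg G v.
Proof. by move=> fGH Gv; rewrite /deg -(scard_bij (is_iso_nbh fGH Gv)). Qed.

Lemma ball_vert_root G o r : vert G o -> ball_vert G o r o.
Proof. by move=> Go; split => //; exists [::]. Qed.

Lemma ball_vert_adj G o r u v : ball_vert G o r u -> adj G u v -> ball_vert G o r.+1 v.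
Proof.
move=> [_ [p [pp pu sp]]] uv; split; first exact: adj_vertr uv.
by exists (rcons p v); rewrite rcons_path pu pp last_rcons size_rcons.
Qed.

Lemma ball_vertS G o r v : ball_vert G o r v -> ball_vert G o r.+1 v.
Proof. by move=> [Gv [p [? ? ?]]]; split => //; exists p; split => //; exact: leqW. Qed.

(** All neighbours of a vertex within distance [r] lie within distance [r.+1], so only the outermost
    sphere of a ball loses edges. Hence radius 2 suffices to see the degrees of the root and of its
    neighbours. *)
Lemma nbh_gball G o r u : ball_vert G o r u -> nbh (gball G o r.+1) u = nbh G u.
Proof.
move=> ou; apply/seteqP; split => w /=; rewrite /nbh /=; first by case/and3P.
move=> uw; apply/and3P; split => //; rewrite inE; first exact: ball_vertS.
exact: ball_vert_adj ou uw.
Qed.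

Lemma gball_root G o r : vert G o -> vert (gball G o r) o.
Proof. by move=> Go; split => //; exact: ball_vert_root. Qed.

(** Induction on the radius: dropping the last step of a walk shows that its endpoint is the root or
    adjacent to a vertex of the smaller ball, and each neighbourhood is finite. *)
Lemma finite_ball_vert G o r : locally_finite G -> vert G o ->
  finite_set (ball_vert G o r).
Proof.
move=> lfG Go; elim: r => [|r IHr].
  apply: (@sub_finite_set _ _ [set o]); last exact: finite_set1.
  by move=> v [_ [[|x p] [_ /= <- //]]].
apply: (@sub_finite_set _ _ (ball_vert G o r `|` \bigcup_(u in ball_vert G o r) nbh G u)).
  move=> v [Gv [p]]; case/lastP: p => [|p w].
    by move=> [_ /= <- _]; left; exact: ball_vert_root.
  rewrite rcons_path last_rcons size_rcons => -[/andP[pp aw] <- sp].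
  right; exists (last o p) => //; split; last by exists p.
  exact: adj_vert aw.
rewrite finite_setU; split => //; apply: bigcup_finite => // u [Gu _].
exact: lfG.
Qed.

Lemma finite_gball G o r : locally_finite G -> vert G o ->
  finite_set (vert (gball G o r)).
Proof. by move=> lfG Go; apply: finite_setIr; exact: finite_ball_vert. Qed.

Lemma finite_locally_finite G : finite_set (vert G) -> locally_finite G.
Proof. by move=> fG v _; apply: sub_finite_set fG => u /adj_vertr. Qed.

Lemma is_iso_path f G H u p : is_iso f G H -> vert G u -> path (adj G) u p ->
  path (adj H) (f u) (map f p).
Proof.
move=> fGH; elim: p u => //= x p IH u Gu /andP[ux xp].
have Gx := adj_vertr ux.
by rewrite fGH.2// ux/=; exact: IH.
Qed.

Lemma is_iso_ball f G H o r u : is_iso f G H -> vert G o ->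
  ball_vert G o r u -> ball_vert H (f o) r (f u).
Proof.
move=> fGH Go [Gu [p [pp <- sp]]]; have [fh _ _] := fGH.1; split.
  apply: fh; case: p pp {sp Gu} => //= x p /andP[ox].
  by elim: p x {ox}(adj_vertr ox) => //= y p IH x _ /andP[xy]; apply: IH; exact: adj_vertr xy.
exists (map f p); split; [exact: is_iso_path fGH Go pp|exact: last_map|by rewrite size_map].
Qed.

Lemma gball_iso f G H o r : is_iso f G H -> vert G o ->
  rooted_iso (gball G o r) o (gball H (f o) r) (f o).
Proof.
move=> fGH Go; have [g [gHG gf]] := is_iso_inv fGH.
have [[fh fi fs] fa] := fGH; have Hfo : vert H (f o) by exact: fh.
(* The inverse isomorphism carries the ball around [f o] back, which makes the restriction of [f]
   surjective onto it. *)
have ballE u : vert G u -> ball_vert H (f o) r (f u) -> ball_vert G o r u.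
  by move=> Gu /(is_iso_ball gHG Hfo); rewrite !gf.
exists f; split => //.
- split.
  + by move=> u [Gu ou]; split; [exact: fh|exact: is_iso_ball fGH Go ou].
  + by move=> u v /set_mem[Gu _] /set_mem[Gv _]; apply: fi; rewrite inE.
  + move=> w [Hw ow]; have [u Gu fu] := fs _ Hw; exists u => //.
    by split => //; apply: ballE => //; rewrite fu.
- move=> u v [Gu ou] [Gv ov] /=; rewrite fa//; congr (_ && _).
  by rewrite !mem_set//; [exact: is_iso_ball fGH Go ov|exact: is_iso_ball fGH Go ou].
Qed.

(** * Countably many codes for finite graphs *)

Section Code.
Variable c : nat * seq (nat * nat).

(** The list is read symmetrically, and loops and labels out of range are discarded, so every pair
    codes a graph. Codes are countable data and can be pickled into [nat]. *)
Let cadj : rel nat := fun u v =>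
  [&& u < c.1, v < c.1, u != v & ((u, v) \in c.2) || ((v, u) \in c.2)]%N.

Lemma cadj_sym : symmetric cadj.
Proof. by move=> u v; rewrite /cadj andbCA eq_sym [in RHS]orbC. Qed.

Lemma cadj_irr : irreflexive cadj.
Proof. by move=> u; rewrite /cadj eqxx !andbF. Qed.

Lemma cadj_vert u v : cadj u v -> [set i | i < c.1]%N u.
Proof. by case/and4P. Qed.

Definition code_graph : graph := Graph cadj_sym cadj_irr cadj_vert.
End Code.

Lemma finite_code_graph c : finite_set (vert (code_graph c)).
Proof. exact: finite_II. Qed.

Lemma finite_graph_code G : finite_set (vert G) ->
  exists c, graph_iso G (code_graph c).
Proof.
move=> fG; have [n /card_set_bijP[f fb]] := (finite_setP _).1 fG.
have [g [gb gf _]] := set_bij_inv fb.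
pose e := [seq p <- [seq (i, j) | i <- iota 0 n, j <- iota 0 n] | adj G (g p.1) (g p.2)].
exists (n, e), f; split=> // u v Gu Gv /=.
have fn x : vert G x -> (f x < n)%N by case: fb => + _ _; exact.
have eP x y : vert G x -> vert G y -> ((f x, f y) \in e) = adj G x y.
  move=> Gx Gy; rewrite mem_filter /= !gf//.
  by rewrite allpairs_f ?andbT// mem_iota add0n leq0n/= fn.
rewrite !fn//= !eP// [adj G v u]adj_sym orbb.
by case: eqP => //= /(congr1 g); rewrite !gf// => ->; rewrite adj_irr.
Qed.

(** An enumeration of the finite rooted graphs up to isomorphism; indices that code nothing are sent
    to the one-point graph. *)
Definition code_rgraph (i : nat) : Defs.rgraph :=
  if unpickle i is Some (c, o) then
    if pselect (vert (code_graph c) o) is left h then RGraph h else point_rgraph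
  else point_rgraph.

Lemma finite_rgraph_code G o : finite_set (vert G) -> vert G o ->
  exists i, rooted_iso G o (code_rgraph i) (Defs.root (code_rgraph i)).
Proof.
move=> fG Go; have [c [f [fb fa]]] := finite_graph_code fG.
exists (pickle (c, f o)); rewrite /code_rgraph pickleK; case: pselect => [h|[]].
  by exists f.
by case: fb => + _ _; apply.
Qed.

Lemma gball_code G o r : locally_finite G -> vert G o -> exists i,
  rooted_iso (gball G o r) o (code_rgraph i) (Defs.root (code_rgraph i)).
Proof.
move=> lfG Go; apply: finite_rgraph_code; first exact: finite_gball.
exact: gball_root.
Qed.

(** * Local functionals and classes of 2-balls *)

Definition iso_invariant (T : Type) (phi : graph -> nat -> T) : Prop :=
  forall f G H v, is_iso f G H -> vert G v -> phi H (f v) = phi G v.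

Definition ball2_local (T : Type) (phi : graph -> nat -> T) : Prop :=
  forall G o, vert G o -> phi (gball G o 2) o = phi G o.

Lemma ball2_iso_eq (T : Type) (phi : graph -> nat -> T) G o H p :
  iso_invariant phi -> ball2_local phi -> vert G o -> vert H p ->
  rooted_iso (gball G o 2) o (gball H p 2) p -> phi G o = phi H p.
Proof.
move=> inv loc Go Hp [f [fb fa fo]].
have := inv _ _ _ o (conj fb fa) (gball_root 2 Go).
by rewrite fo !loc.
Qed.

Definition gmean (R : realType) (phi : graph -> nat -> R) (G : graph) : R :=
  unif_mean (vert G) (phi G).

Lemma gmean_iso (R : realType) (phi : graph -> nat -> R) G H :
  iso_invariant phi -> graph_iso G H -> gmean phi G = gmean phi H.
Proof.
move=> inv [f fGH]; apply: (unif_mean_bij fGH.1) => v Gv.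
exact/esym/inv.
Qed.

Lemma gmean_infinite (R : realType) (phi : graph -> nat -> R) G :
  ~ finite_set (vert G) -> gmean phi G = 0.
Proof. by move=> iG; rewrite /gmean /unif_mean scard_infinite// invr0 mulr0. Qed.

(** * The degree and the neighbour average as local functionals *)

Section DegreeFunctionals.
Variable R : realType.

Lemma deg_gball G o r u : ball_vert G o r u -> deg (gball G o r.+1) u = deg G u.
Proof. by move=> ou; rewrite /deg nbh_gball. Qed.

Lemma deg_invariant : iso_invariant deg.
Proof. by move=> f G H v; exact: is_iso_deg. Qed.

Lemma deg_local : ball2_local deg.
Proof. by move=> G o Go; rewrite deg_gball//; apply/ball_vertS/ball_vert_root. Qed.

(** The integrand of [rho_mu] with a free function [F] in place of [midsum Fstar_mu], so that it
    serves both for the random graphs and for the limit. *)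
Definition nbh_mean (F : nat -> R) (G : graph) (o : nat) : R :=
  unif_mean (nbh G o) (fun V => (deg G o)%:R * F (deg G o) * F (deg G V)).

Lemma nbh_mean_invariant F : iso_invariant (nbh_mean F).
Proof.
move=> f G H v fGH Gv; apply/esym/(unif_mean_bij (is_iso_nbh fGH Gv)) => u vu.
by rewrite !(is_iso_deg fGH)//; exact: adj_vertr vu.
Qed.

Lemma nbh_mean_local F : ball2_local (nbh_mean F).
Proof.
move=> G o Go; have o1 : ball_vert G o 1 o by exact/ball_vertS/ball_vert_root.
rewrite /nbh_mean nbh_gball// deg_gball//; apply: eq_unif_mean => u ou.
by rewrite deg_gball//; apply: ball_vert_adj ou; exact: ball_vert_root.
Qed.

(** The factor [deg G o] cancels the normalisation of the uniform neighbour. In degree 0 the list of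
    neighbours is empty and both sides vanish. *)
Lemma unif_mean_nbhE (h : nat -> R) G o :
  unif_mean (nbh G o) (fun V => (deg G o)%:R * h V) = \sum_(V <- fset_set (nbh G o)) h V.
Proof.
rewrite unif_meanE -mulr_sumr mulrAC -/(deg G o).
have [d0|d0] := eqVneq (deg G o) 0%N; last by rewrite divff ?mul1r// pnatr_eq0.
rewrite d0 mul0r mul0r; move: d0; rewrite /deg /scard => /eqP.
by rewrite cardfs_eq0 => /eqP ->; rewrite big_seq_fset0.
Qed.

Lemma nbh_meanE F G o : nbh_mean F G o =
  \sum_(V <- fset_set (nbh G o)) (F (deg G o) * F (deg G V)).
Proof.
by rewrite -unif_mean_nbhE /nbh_mean; apply: eq_unif_mean => v _; rewrite mulrA.
Qed.

Lemma ler_norm_nbh_mean (c : R) (h : nat -> R) G o : (forall V, `|h V| <= c) ->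
  `|\sum_(V <- fset_set (nbh G o)) h V| <= c * (deg G o)%:R.
Proof.
move=> hc; apply: (le_trans (ler_norm_sum _ _ _)).
apply: (@le_trans _ _ (\sum_(V <- fset_set (nbh G o)) c)); first exact: ler_sum.
by rewrite big_const_seq count_predT iter_addr_0 mulr_natr.
Qed.

End DegreeFunctionals.

Section Class.

Let isocode (G : graph) (o i : nat) : bool :=
  `[< rooted_iso (gball G o 2) o (code_rgraph i) (Defs.root (code_rgraph i)) >].

(** Taking the least code makes the label canonical: locally finite graphs get equal labels exactly
    when their rooted 2-balls are isomorphic. The default 0 is reached only if no code exists. *)
Definition ball_class (G : graph) (o : nat) : nat :=
  if pselect (exists i, isocode G o i) is left h then ex_minn h else 0%N.

Lemma ball_classP G o : locally_finite G -> vert G o ->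
  isocode G o (ball_class G o) /\ forall j, isocode G o j -> (ball_class G o <= j)%N.
Proof.
move=> lfG Go; rewrite /ball_class; case: pselect => [h|[]].
  by case: ex_minnP.
by have [i /asboolP] := gball_code 2 lfG Go; exists i.
Qed.

Definition least_code (i : nat) : bool :=
  `[< forall j, (j < i)%N -> ~ rooted_iso
    (code_rgraph j) (Defs.root (code_rgraph j))
    (code_rgraph i) (Defs.root (code_rgraph i)) >].

(** An index that codes the 2-ball and has no smaller isomorphic code must be the minimum defining
    [ball_class]. This turns class events into the ball events that local convergence controls. *)
Lemma ball_class_eq G o i : locally_finite G -> vert G o ->
  (ball_class G o == i) = least_code i &&
  `[< rooted_iso (gball G o 2) o (code_rgraph i) (Defs.root (code_rgraph i)) >].
Proof.
move=> lfG Go; have [/asboolP cl mincl] := ball_classP lfG Go.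
have Go2 := gball_root 2 Go.
apply/eqP/andP => [<-|[/asboolP can /asboolP iso]].
  split; apply/asboolP => // j ji jiso.
  have : isocode G o j.
    apply/asboolP/(rooted_iso_trans cl)/rooted_iso_sym => //; exact: root_vert.
  by move/mincl; rewrite leqNgt ji.
have := mincl i; rewrite leq_eqVlt => /(_ (asboolT iso))/orP[/eqP//|lt].
by have := can _ lt (rooted_iso_trans (rooted_iso_sym Go2 cl) iso).
Qed.

Lemma ball_class_factor (T : Type) (phi : graph -> nat -> T) G o H p :
  iso_invariant phi -> ball2_local phi ->
  locally_finite G -> vert G o -> locally_finite H -> vert H p ->
  ball_class G o = ball_class H p -> phi G o = phi H p.
Proof.
move=> inv loc lfG Go lfH Hp e.
have [/asboolP Giso _] := ball_classP lfG Go.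
have [/asboolP Hiso _] := ball_classP lfH Hp.
apply: ball2_iso_eq => //; rewrite e in Giso; apply: (rooted_iso_trans Giso).
by apply: rooted_iso_sym => //; exact: gball_root.
Qed.

(** The chosen representative does not affect the value for invariant 2-local functionals, by
    [ball_class_factor]; classes that no rooted graph realises get 0. *)
Definition class_value (R : realType) (phi : graph -> nat -> R) (i : nat) : R :=
  if pselect (exists g : Defs.rgraph, locally_finite g /\ ball_class g (Defs.root g) = i)
  is left h then let g := projT1 (cid h) in phi g (Defs.root g) else 0.

Lemma class_valueE (R : realType) (phi : graph -> nat -> R) G o :
  iso_invariant phi -> ball2_local phi -> locally_finite G -> vert G o ->
  phi G o = class_value phi (ball_class G o).
Proof.
move=> inv loc lfG Go; rewrite /class_value; case: pselect => [h|[]].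
  case: cid => /= g [lfg e]; apply: ball_class_factor => //; exact: root_vert.
by exists (RGraph Go).
Qed.

Lemma class_value_le (R : realType) (phi : graph -> nat -> R) (c : R) i : 0 <= c ->
  (forall G v, locally_finite G -> vert G v -> `|phi G v| <= c) ->
  `|class_value phi i| <= c.
Proof.
move=> c0 phic; rewrite /class_value; case: pselect => [h|_]; last by rewrite normr0.
by case: cid => /= g [lfg _]; apply: phic => //; exact: root_vert.
Qed.

End Class.

Definition at_root (T : Type) (phi : graph -> nat -> T) (g : clrgraph) : T :=
  phi g (Defs.root g).

(** * Measurability of local functionals and of functionals of random graphs *)

Section MeasurableClass.

Lemma measurable_ball_event r H : measurable (ball_event r H : set local_space).
Proof. by apply: sub_sigma_algebra; exists r, H. Qed.

Definition root_class (g : clrgraph) : nat := ball_class g (Defs.root g).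

Lemma root_class_event i : [set g | root_class g = i] =
  if least_code i then ball_event 2 (code_rgraph i) else set0.
Proof.
have E (g : clrgraph) := ball_class_eq i (@clr_locally_finite g) (root_vert g).
apply/seteqP; split => g /=.
  by move/eqP; rewrite E; case: least_code => //= /asboolP.
move=> h; apply/eqP; rewrite E; case: least_code h => //= h; exact/asboolP.
Qed.

Lemma measurable_root_class i : measurable ([set g | root_class g = i] : set local_space).
Proof.
rewrite root_class_event; case: least_code => //; exact: measurable_ball_event.
Qed.

(** The functional factors through the [nat]-valued [root_class], so each preimage is a countable
    union of class events. *)
Lemma measurable_local (R : realType) (phi : graph -> nat -> R) :
  iso_invariant phi -> ball2_local phi ->
  measurable_fun setT (at_root phi : local_space -> R).
Proof.
move=> inv loc _ Y _; rewrite setTI.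
rewrite (_ : _ @^-1` _ = \bigcup_(i in [set i | Y (class_value phi i)])
    [set g | root_class g = i]).
  by apply: bigcup_measurable => i _; exact: measurable_root_class.
have E (g : clrgraph) := class_valueE inv loc (@clr_locally_finite g) (root_vert g).
apply/seteqP; split => [g /= Yg|g [i /= Yi gi]].
  by exists (root_class g) => //=; rewrite -E.
by rewrite /= /at_root E -/(root_class g) gi.
Qed.

End MeasurableClass.

(** Finite graphs fall into countably many isomorphism classes, and [Q] is constant on each of them
    and on all infinite graphs. The event is thus a countable union of class events, joined with the
    event of infinite graphs if their common value is attained and lies in [Y]. *)
Lemma measurable_graph_functional (d : measure_display) (Om : measurableType d)
    (G : Om -> graph) (T : Type) (Q : graph -> T) (Y : set T) :
  measurable_graph G ->
  (forall H K, graph_iso H K -> finite_set (vert H) -> Q H = Q K) ->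
  (forall H K, ~ finite_set (vert H) -> ~ finite_set (vert K) -> Q H = Q K) ->
  measurable [set w | Y (Q (G w))].
Proof.
move=> mG Qiso Qinf.
pose C i := code_graph (odflt (0%N, [::]) (choice.unpickle i)).
pose A i := [set w | graph_iso (G w) (C i)].
have mA i : measurable (A i) by apply: mG; exact: finite_code_graph.
have AP w : finite_set (vert (G w)) <-> exists i, A i w.
  split=> [/finite_graph_code[c cP]|[i [f [fb _]]]].
    by exists (choice.pickle c); rewrite /A /C/= choice.pickleK.
  have [g [gb _ _]] := set_bij_inv fb.
  by rewrite -(set_bij_image gb); apply: finite_image; exact: finite_code_graph.
have mF : measurable (\bigcup_i A i) by exact: bigcup_measurable.
have mYF : measurable (\bigcup_(i in [set i | Y (Q (C i))]) A i).
  by apply: bigcup_measurable => i _.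
have FE w : (\bigcup_i A i) w <-> finite_set (vert (G w)).
  by split=> [[i _ Ai]|/AP[i Ai]]; [apply/AP; exists i|exists i].
have [[w0 [iw0 Yw0]]|no] :=
    pselect (exists w, ~ finite_set (vert (G w)) /\ Y (Q (G w))).
  suff -> : [set w | Y (Q (G w))] =
      (\bigcup_(i in [set i | Y (Q (C i))]) A i) `|` ~` (\bigcup_i A i).
    by apply: measurableU => //; exact: measurableC.
  apply/seteqP; split => w /=.
    move=> Yw; have [fw|nfw] := pselect (finite_set (vert (G w))).
      have /AP[i Ai] := fw; left; exists i => //=; by rewrite -(Qiso (G w)).
    by right=> /FE.
  move=> [[i /= Yi Ai]|nA].
    by rewrite (Qiso _ _ Ai)//; apply/AP; exists i.
  by rewrite (Qinf _ (G w0))// => /FE.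
suff -> : [set w | Y (Q (G w))] = (\bigcup_(i in [set i | Y (Q (C i))]) A i) by [].
apply/seteqP; split => w /=.
  move=> Yw; have fw : finite_set (vert (G w)).
    by apply: contrapT => nfw; apply: no; exists w.
  by have /AP[i Ai] := fw; exists i => //=; rewrite -(Qiso (G w)).
move=> [i /= Yi Ai]; by rewrite (Qiso _ _ Ai)//; apply/AP; exists i.
Qed.

(** * Bounded functionals *)

Section Limit.
Variables (R : realType) (mu : probability local_space R).

Definition lmean (phi : graph -> nat -> R) : R :=
  \int[mu]_(g in setT) at_root phi g.

Definition class_prob (i : nat) : R := fine (mu [set g | root_class g = i]).

Definition class_tail (M : nat) : set local_space := [set g | (M <= root_class g)%N].

Lemma measurable_class_tail M : measurable (class_tail M).
Proof.
rewrite (_ : class_tail M = \bigcup_(i in [set i | (M <= i)%N])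
    [set g | root_class g = i]).
  by apply: bigcup_measurable => i _; exact: measurable_root_class.
apply/seteqP; split => [g Mg|g [i Mi gi]]; first by exists (root_class g).
by rewrite /class_tail/= gi.
Qed.

Lemma bounded_local_integrable (phi : graph -> nat -> R) (c : R) D :
  iso_invariant phi -> ball2_local phi -> measurable D ->
  (forall G v, locally_finite G -> vert G v -> `|phi G v| <= c) ->
  mu.-integrable D (EFin \o at_root phi).
Proof.
move=> inv loc mD phic; apply: measurable_bounded_integrable => //.
- exact: (le_lt_trans (probability_le1 mu mD) (ltry _)).
- apply: (@measurable_funS _ _ _ _ setT) => //; exact: measurable_local.
- exists c; split; first exact: num_real.
  move=> x cx g _; apply: le_trans (ltW cx).
  apply: phic; [exact: (@clr_locally_finite g)|exact: root_vert].
Qed.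

(** Induction on [M]: the class labelled [M], on which [phi] is constant, is peeled off the tail. *)
Lemma lmean_class_split (phi : graph -> nat -> R) (c : R) M :
  iso_invariant phi -> ball2_local phi ->
  (forall G v, locally_finite G -> vert G v -> `|phi G v| <= c) ->
  lmean phi = \sum_(i < M) class_value phi i * class_prob i +
    \int[mu]_(g in class_tail M) at_root phi g.
Proof.
move=> inv loc phic.
have E (g : clrgraph) := class_valueE inv loc (@clr_locally_finite g) (root_vert g).
elim: M => [|M IH].
  by rewrite big_ord0 add0r; congr (Rintegral _ _ _); apply/seteqP; split.
rewrite IH big_ord_recr/= -addrA; congr (_ + _).
have -> : class_tail M = [set g | root_class g = M] `|` class_tail M.+1.
  apply/seteqP; split => g; rewrite /class_tail /= [(M <= _)%N]leq_eqVlt.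
    by case/orP => [/eqP|]; [left|right].
  by move=> [->|->]; rewrite ?eqxx ?orbT.
have mM := measurable_root_class M; have mt := measurable_class_tail M.+1.
rewrite Rintegral_setU//.
- congr (_ + _); rewrite -Rintegral_cst//; apply: eq_Rintegral => g /set_mem/= gM.
  by rewrite /at_root E -/(root_class g) gM.
- by apply: bounded_local_integrable phic => //; exact: measurableU.
- by apply/disj_setPS => g [/= gM]; rewrite /class_tail/= gM ltnn.
Qed.

Lemma class_tailE M : fine (mu (class_tail M)) = 1 - \sum_(i < M) class_prob i.
Proof.
have cstE D : measurable D -> \int[mu]_(g in D) at_root (fun _ _ => 1) g = fine (mu D).
  by move=> mD; rewrite [LHS](Rintegral_cst mu mD 1) mul1r.
have := @lmean_class_split (fun _ _ => 1) 1 M.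
rewrite /lmean (cstE _ (measurable_class_tail M)) (cstE _ measurableT) probability_setT/=.
move=> ->//; last by move=> *; rewrite normr1.
rewrite addrAC [X in X - _](_ : _ = \sum_(i < M) class_prob i) ?subrr ?add0r//.
(* The value of the constant 1 on a class is 1, except for the default 0 on unrealised classes, and
   these have probability 0. *)
apply: eq_bigr => i _; rewrite /class_value; case: pselect => [h|no].
  by rewrite mul1r.
rewrite mul0r /class_prob (_ : [set g | _] = set0) ?measure0//.
apply/seteqP; split => // g /= gi; apply: no; exists g; split => //.
exact: clr_locally_finite.
Qed.

(** Tightness of the class label: the tails decrease to the empty set, so continuity from above
    applies. *)
Lemma class_tail_small (eps : R) : 0 < eps ->
  exists M, 1 - \sum_(i < M) class_prob i <= eps.
Proof.
move=> eps0; have : mu \o class_tail @ \oo --> mu (\bigcap_n class_tail n).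
  apply: nonincreasing_cvg_mu => //.
  - exact: (le_lt_trans (probability_le1 mu (measurable_class_tail 0)) (ltry _)).
  - exact: measurable_class_tail.
  - by apply: bigcapT_measurable; exact: measurable_class_tail.
  - move=> m n mn; apply/subsetPset => g; rewrite /class_tail /=; exact: leq_trans.
rewrite (_ : \bigcap_n _ = set0) ?measure0; last first.
  by apply/seteqP; split => // g /(_ (root_class g).+1 Logic.I); rewrite /class_tail/= ltnn.
move/fine_cvgP => [_ /cvgrPdist_le /(_ _ eps0)] [M _ /(_ M (leqnn _))].
rewrite /= sub0r normrN class_tailE => h; exists M; apply: le_trans h; exact: ler_norm.
Qed.

Lemma lmean_class_approx (phi : graph -> nat -> R) (c : R) M :
  iso_invariant phi -> ball2_local phi ->
  (forall G v, locally_finite G -> vert G v -> `|phi G v| <= c) ->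
  `|lmean phi - \sum_(i < M) class_value phi i * class_prob i| <=
  c * (1 - \sum_(i < M) class_prob i).
Proof.
move=> inv loc phic; rewrite (lmean_class_split M inv loc phic) addrAC subrr add0r.
have mt := measurable_class_tail M.
have int := bounded_local_integrable inv loc mt phic.
apply: (le_trans (le_normr_Rintegral mt int)).
rewrite -class_tailE -Rintegral_cst//; apply: le_Rintegral => //.
- exact: (integrable_norm int).
- by apply: (@bounded_local_integrable (fun _ _ => c) `|c|).
- move=> g _; apply: phic; [exact: (@clr_locally_finite g)|exact: root_vert].
Qed.

End Limit.

Lemma sum_class (R : pzRingType) (f : nat -> R) M c :
  \sum_(i < M) f i * (c == i :> nat)%:R = if (c < M)%N then f c else 0.
Proof.
case: ltnP => cM.
  rewrite (bigD1 (Ordinal cM))//= eqxx mulr1 big1 ?addr0// => i /negPf.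
  by rewrite -val_eqE/= eq_sym => ->; rewrite mulr0.
by rewrite big1// => i _; rewrite gtn_eqF ?mulr0// (leq_trans (ltn_ord i)).
Qed.

Definition class_freq (R : realType) (i : nat) (G : graph) : R :=
  gmean (fun G v => (ball_class G v == i)%:R) G.

(** Vertices whose class is below [M] are counted exactly by the sum; each of the others costs at
    most [c]. *)
Lemma gmean_class_approx (R : realType) (phi : graph -> nat -> R) (c : R) M G :
  iso_invariant phi -> ball2_local phi -> 0 <= c ->
  (forall G v, locally_finite G -> vert G v -> `|phi G v| <= c) ->
  scard (vert G) != 0%N ->
  `|gmean phi G - \sum_(i < M) class_value phi i * class_freq R i G| <=
  c * (1 - \sum_(i < M) class_freq R i G).
Proof.
move=> inv loc c0 phic G0.
have fG : finite_set (vert G) by apply: contrapT => /scard_infinite; apply/eqP.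
have E v := @class_valueE _ _ G v inv loc (finite_locally_finite fG).
have sumE (f : nat -> R) : \sum_(i < M) f i * class_freq R i G =
    unif_mean (vert G) (fun v => \sum_(i < M) f i * (ball_class G v == i)%:R).
  rewrite (unif_mean_sum _ M (fun i v => f i * (ball_class G v == i)%:R)).
  by apply: eq_bigr => i _; rewrite unif_meanZ.
have -> : c * (1 - \sum_(i < M) class_freq R i G) = unif_mean (vert G)
    (fun v => c * (1 - \sum_(i < M) 1 * (ball_class G v == i)%:R)).
  rewrite unif_meanZ unif_meanB unif_mean1// -(sumE (fun=> 1)).
  by under [X in _ = _ * (_ - X)]eq_bigr do rewrite mul1r.
rewrite sumE /gmean -unif_meanB.
apply: (le_trans (ler_norm_unif_mean _ _)); apply: le_unif_mean => v Gv.
rewrite E// sum_class (sum_class (fun=> 1)); case: ltnP => _; first by rewrite !subrr normr0 mulr0.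
by rewrite !subr0 mulr1 -E//; apply: phic => //; exact: finite_locally_finite.
Qed.

Lemma class_freqE (R : realType) i G : finite_set (vert G) ->
  class_freq R i G = (least_code i)%:R * ball_freq R (code_rgraph i) 2 G.
Proof.
move=> fG; rewrite /class_freq /gmean /ball_freq -unif_meanZ.
apply: eq_unif_mean => v Gv; rewrite ball_class_eq//; last exact: finite_locally_finite.
by rewrite -natrM mulnb.
Qed.

Lemma class_probE (R : realType) (mu : probability local_space R) i :
  class_prob mu i = (least_code i)%:R * fine (mu (ball_event 2 (code_rgraph i))).
Proof.
rewrite /class_prob root_class_event; case: least_code; first by rewrite mul1r.
by rewrite measure0 mul0r.
Qed.

(* A Scheffe-type argument: the classes below M carry almost all the mass of
   the limit, hence also of G as soon as their frequencies in G are close. *)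
Lemma bounded_gmean_approx (R : realType) (mu : probability local_space R)
    (phi : graph -> nat -> R) (c eps : R) :
  iso_invariant phi -> ball2_local phi ->
  (forall G v, locally_finite G -> vert G v -> `|phi G v| <= c) -> 0 < eps ->
  exists M (delta : R), 0 < delta /\ forall G, scard (vert G) != 0%N ->
    (forall i, (i < M)%N -> `|class_freq R i G - class_prob mu i| <= delta) ->
    `|gmean phi G - lmean mu phi| <= eps.
Proof.
(* A strictly positive bound, by which one can divide. *)
move=> inv loc phic' eps0; pose b := `|c| + 1.
have b0 : 0 < b by rewrite ltr_wpDl.
have phic G v : locally_finite G -> vert G v -> `|phi G v| <= b.
  by move=> lf Gv; apply: (le_trans (phic' _ _ lf Gv)); rewrite (le_trans (ler_norm _))// lerDl.
have [|M HM] := @class_tail_small _ mu (eps / 4 / b); first by rewrite !divr_gt0.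
(* Chosen so that [M] deviations of size [delta] add up to at most [eps / 4 / b]; the successor
   keeps the denominator nonzero when [M] is 0. *)
pose delta := eps / 4 / b / M.+1%:R.
have delta0 : 0 < delta by rewrite !divr_gt0.
exists M, delta; split => // G G0 Gcl.
have Hg := gmean_class_approx M inv loc (ltW b0) phic G0.
have Hl := lmean_class_approx mu M inv loc phic.
have sumd : M%:R * delta <= eps / 4 / b.
  rewrite /delta mulrCA ler_piMr//; first by rewrite ltW// !divr_gt0.
  by rewrite ler_pdivrMr// mul1r ler_nat.
have Hs : `|\sum_(i < M) class_freq R i G - \sum_(i < M) class_prob mu i| <= eps / 4 / b.
  rewrite -sumrB; apply: le_trans sumd; apply: (le_trans (ler_norm_sum _ _ _)).
  rewrite mulr_natl -[M in leRHS]card_ord -sumr_const; apply: ler_sum => i _.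
  exact: Gcl.
have Hv : `|\sum_(i < M) class_value phi i * class_freq R i G -
            \sum_(i < M) class_value phi i * class_prob mu i| <= b * (eps / 4 / b).
  rewrite -sumrB; apply: (@le_trans _ _ (b * (M%:R * delta))); last by rewrite ler_pM2l.
  apply: (le_trans (ler_norm_sum _ _ _)).
  rewrite mulrCA mulr_natl -[M in leRHS]card_ord -sumr_const; apply: ler_sum => i _.
  rewrite -mulrBr normrM ler_pM//; last exact: Gcl.
  by apply: class_value_le => //; exact: ltW.
have be : b * (eps / 4 / b) = eps / 4 by rewrite mulrC divfK// gt_eqF.
rewrite be in Hv.
have Hl' : b * (1 - \sum_(i < M) class_prob mu i) <= eps / 4.
  by rewrite -be ler_pM2l.
(* The mass of [G] outside the first [M] classes is that of [mu] plus the total deviation. The three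
   errors are then [eps / 2] in [G], [eps / 4] in the limit and [eps / 4] between the two sums. *)
have Hg' : b * (1 - \sum_(i < M) class_freq R i G) <= eps / 4 + eps / 4.
  have : 1 - \sum_(i < M) class_freq R i G <= eps / 4 / b + eps / 4 / b.
    by move: Hs; rewrite ler_norml => /andP[]; lra.
  by move=> h; apply: (le_trans (ler_wpM2l (ltW b0) h)); rewrite mulrDr be.
have {Hg}Hg := le_trans Hg Hg'; have {Hl}Hl := le_trans Hl Hl'.
move: Hg Hl Hv; rewrite !ler_norml => /andP[? ?] /andP[? ?] /andP[? ?].
by apply/andP; split; lra.
Qed.

(** * Functionals dominated by the degree *)

Section Truncation.
Variable R : realType.
Implicit Types phi : graph -> nat -> R.

Definition rdeg : graph -> nat -> R := fun G v => (deg G v)%:R.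

Definition degtail (K : nat) : graph -> nat -> R :=
  fun G v => (deg G v)%:R * (K < deg G v)%N%:R.

Definition trunc (M : nat) phi : graph -> nat -> R :=
  fun G v => phi G v * (deg G v <= M)%N%:R.

Lemma of_deg_invariant (T : Type) (h : nat -> T) : iso_invariant (fun G v => h (deg G v)).
Proof. by move=> f G H v fGH Gv; rewrite (deg_invariant fGH Gv). Qed.

Lemma of_deg_local (T : Type) (h : nat -> T) : ball2_local (fun G v => h (deg G v)).
Proof. by move=> G o Go; rewrite deg_local. Qed.

Lemma trunc_invariant M phi : iso_invariant phi -> iso_invariant (trunc M phi).
Proof.
by move=> inv f G H v fGH Gv; rewrite /trunc (inv _ _ _ _ fGH Gv) (deg_invariant fGH Gv).
Qed.

Lemma trunc_local M phi : ball2_local phi -> ball2_local (trunc M phi).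
Proof. by move=> loc G o Go; rewrite /trunc loc// deg_local. Qed.

Lemma rdeg_invariant : iso_invariant rdeg.
Proof. exact: (of_deg_invariant (fun k => k%:R)). Qed.

Lemma rdeg_local : ball2_local rdeg.
Proof. exact: (of_deg_local (fun k => k%:R)). Qed.

Lemma degtail_invariant K : iso_invariant (degtail K).
Proof. exact: (of_deg_invariant (fun k => k%:R * (K < k)%N%:R)). Qed.

Lemma degtail_local K : ball2_local (degtail K).
Proof. exact: (of_deg_local (fun k => k%:R * (K < k)%N%:R)). Qed.

Lemma degtail_ge0 K G v : 0 <= degtail K G v.
Proof. by rewrite mulr_ge0. Qed.

Lemma degtail_le K G v : degtail K G v <= rdeg G v.
Proof. by rewrite ler_piMr// lern1 leq_b1. Qed.

Lemma trunc_le M phi (c : R) G v : 0 <= c ->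
  `|phi G v| <= c * rdeg G v -> `|trunc M phi G v| <= c * M%:R.
Proof.
move=> c0 phic; rewrite /trunc; case: leqP => [dM|_]; last by rewrite mulr0 normr0 mulr_ge0.
by rewrite mulr1; apply: (le_trans phic); rewrite ler_wpM2l// ler_nat.
Qed.

Lemma truncB_le M phi (c : R) G v :
  `|phi G v| <= c * rdeg G v -> `|phi G v - trunc M phi G v| <= c * degtail M G v.
Proof.
move=> phic; rewrite /trunc /degtail ltnNge; case: leqP => _ /=.
  by rewrite mulr1 subrr normr0 !mulr0.
by rewrite mulr0 subr0 mulr1.
Qed.

End Truncation.

(** * Truncation and integrability under the limit law *)

Section TruncatedLimit.
Variables (R : realType) (mu : probability local_space R).
Implicit Types phi : graph -> nat -> R.

Lemma trunc_integrable M phi (c : R) : 0 <= c ->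
  iso_invariant phi -> ball2_local phi ->
  (forall G v, locally_finite G -> vert G v -> `|phi G v| <= c * rdeg R G v) ->
  mu.-integrable setT (EFin \o at_root (trunc M phi)).
Proof.
move=> c0 inv loc phic; apply: (@bounded_local_integrable _ _ _ (c * M%:R)) => //.
- exact: trunc_invariant.
- exact: trunc_local.
- by move=> G v lf Gv; apply: trunc_le => //; exact: phic.
Qed.

(* Monotone convergence along the truncations at degree M. *)
Lemma trunc_lmean_le phi (b : R) :
  iso_invariant phi -> ball2_local phi ->
  (forall G v, 0 <= phi G v) -> (forall G v, phi G v <= rdeg R G v) ->
  (forall M, lmean mu (trunc M phi) <= b) ->
  mu.-integrable setT (EFin \o at_root phi) /\ lmean mu phi <= b.
Proof.
move=> inv loc phi0 phid hb.
have mphi := measurable_local inv loc.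
have intM M : mu.-integrable setT (EFin \o at_root (trunc M phi)).
  apply: (@trunc_integrable M phi 1) => // G v _ _.
  by rewrite ger0_norm// mul1r.
have t0 M G v : 0 <= trunc M phi G v by rewrite mulr_ge0.
have cvg : (\int[mu]_(g in setT) (at_root (trunc M phi) g)%:E)%E @[M --> \oo] -->
    (\int[mu]_(g in setT) (limn (fun M => (at_root (trunc M phi) g)%:E)))%E.
  apply: cvg_monotone_convergence => //.
  - by move=> M; exact: (measurable_int mu (intM M)).
  - by move=> M g _; rewrite lee_fin; exact: t0.
  - move=> g _ m n mn; rewrite lee_fin; rewrite /at_root /trunc ler_wpM2l// ler_nat.
    by case: (boolP (_ <= m)%N) => // dm; rewrite (leq_trans dm mn).
have limE g : limn (fun M => (at_root (trunc M phi) g)%:E) = (at_root phi g)%:E.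
  (* For a fixed rooted graph the truncations are constant once [M] reaches the root degree. *)
  apply: cvg_lim => //; apply: cvg_near_cst; exists (root_deg g) => // M /= dM.
  by rewrite /at_root /trunc /root_deg in dM *; rewrite dM mulr1.
have limI : (\int[mu]_(g in setT) (limn (fun M => (at_root (trunc M phi) g)%:E)))%E =
    (\int[mu]_(g in setT) (at_root phi g)%:E)%E.
  by apply: eq_integral => g _; rewrite limE.
rewrite limI in cvg.
have le : (\int[mu]_(g in setT) (at_root phi g)%:E <= b%:E)%E.
  have := cvg; move/cvg_lim => <- //; apply: lime_le.
    by apply/cvg_ex; eexists; exact: cvg.
  apply: nearW => M; rewrite -[X in (X <= _)%E]fineK; first by rewrite lee_fin; exact: hb.
  exact: (integrable_fin_num measurableT (intM M)).
have int : mu.-integrable setT (EFin \o at_root phi).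
  apply/integrableP; split; first exact/measurable_EFinP.
  rewrite (_ : (fun x => `|_|)%E = (fun g => (at_root phi g)%:E)).
    exact: le_lt_trans le (ltry _).
  by apply/funext => g /=; rewrite ger0_norm//; exact: phi0.
split=> //; rewrite /lmean -lee_fin /Rintegral fineK//.
exact: (integrable_fin_num measurableT int).
Qed.

Lemma degtail_lmean_le K (eps : R) :
  (forall M, lmean mu (trunc M (degtail R K)) <= eps) ->
  mu.-integrable setT (EFin \o at_root (degtail R K)) /\ lmean mu (degtail R K) <= eps.
Proof.
apply: trunc_lmean_le.
- exact: degtail_invariant.
- exact: degtail_local.
- exact: degtail_ge0.
- exact: degtail_le.
Qed.

Hypothesis tail_bounded :
  exists K (b : R), forall M, lmean mu (trunc M (degtail R K)) <= b.

(** The degree is at most [K] plus its tail beyond [K], and the tail is integrable by monotone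
    convergence. *)
Lemma rdeg_integrable : mu.-integrable setT (EFin \o at_root (rdeg R)).
Proof.
have [K [b /degtail_lmean_le[iK _]]] := tail_bounded.
have iC : mu.-integrable setT (EFin \o cst (K%:R : R)).
  by apply: finite_measure_integrable_cst.
apply: (le_integrable measurableT _ _ (integrableD measurableT iC iK)).
  by apply/measurable_EFinP; exact: (measurable_local (@rdeg_invariant R) (@rdeg_local R)).
move=> g _; rewrite /= lee_fin /at_root /rdeg /degtail !ger0_norm//.
case: ltnP => dK; first by rewrite mulr1 lerDr.
by rewrite mulr0 addr0 ler_nat.
Qed.

Lemma dominated_integrable phi (c : R) :
  iso_invariant phi -> ball2_local phi ->
  (forall G v, locally_finite G -> vert G v -> `|phi G v| <= c * rdeg R G v) ->
  mu.-integrable setT (EFin \o at_root phi).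
Proof.
move=> inv loc phic.
apply: (le_integrable measurableT _ _ (integrableZl measurableT c rdeg_integrable)).
  by apply/measurable_EFinP; exact: measurable_local.
move=> g _ /=; rewrite lee_fin; apply: (le_trans _ (ler_norm _)).
by apply: phic; [exact: (@clr_locally_finite g)|exact: root_vert].
Qed.

Lemma lmean_truncB_le M phi (c : R) : 0 <= c ->
  iso_invariant phi -> ball2_local phi ->
  (forall G v, locally_finite G -> vert G v -> `|phi G v| <= c * rdeg R G v) ->
  `|lmean mu phi - lmean mu (trunc M phi)| <= c * lmean mu (degtail R M).
Proof.
move=> c0 inv loc phic.
have i1 := dominated_integrable inv loc phic.
have i2 := trunc_integrable M c0 inv loc phic.
have i3 : mu.-integrable setT (EFin \o at_root (degtail R M)).
  apply: (@dominated_integrable _ 1) => [||G v _ _].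
  - exact: degtail_invariant.
  - exact: degtail_local.
  - by rewrite mul1r ger0_norm ?degtail_ge0// degtail_le.
have i12 : mu.-integrable setT (EFin \o (fun g => at_root phi g - at_root (trunc M phi) g)).
  exact: (integrableB measurableT i1 i2).
rewrite /lmean -RintegralB// -RintegralZl//.
apply: (le_trans (le_normr_Rintegral measurableT i12)); apply: le_Rintegral => //.
- exact: (integrable_norm i12).
- exact: (integrableZl measurableT c i3).
- move=> g _; apply: truncB_le; apply: phic;
    [exact: (@clr_locally_finite g)|exact: root_vert].
Qed.

End TruncatedLimit.

Lemma gmean_truncB_le (R : realType) M (phi : graph -> nat -> R) (c : R) G :
  finite_set (vert G) ->
  (forall G v, locally_finite G -> vert G v -> `|phi G v| <= c * rdeg R G v) ->
  `|gmean phi G - gmean (trunc M phi) G| <= c * gmean (degtail R M) G.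
Proof.
move=> fG phic; rewrite /gmean -unif_meanB -unif_meanZ.
apply: (le_trans (ler_norm_unif_mean _ _)); apply: le_unif_mean => v Gv.
by apply: truncB_le; apply: phic => //; exact: finite_locally_finite.
Qed.

(** * Convergence in probability *)

Section Probability.
Variables (R : realType) (d : nat -> measure_display).
Variables (Om : forall n, measurableType (d n)).
Variables (P : forall n, probability (Om n) R).

(* Outer bounds, so that intermediate events need not be measurable. *)
Definition prob_le (eta : R) (E : forall n, set (Om n)) : Prop :=
  exists N : forall n, set (Om n),
    [/\ forall n, measurable (N n), forall n, E n `<=` N n &
        \forall n \near \oo, (P n (N n) <= eta%:E)%E].

Definition negligible_seq (E : forall n, set (Om n)) : Prop :=
  forall eta : R, 0 < eta -> prob_le eta E.

Lemma prob_leU (a b : R) (E F : forall n, set (Om n)) :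
  prob_le a E -> prob_le b F -> prob_le (a + b) (fun n => E n `|` F n).
Proof.
move=> [M [mM EM aM]] [N [mN FN bN]]; exists (fun n => M n `|` N n); split.
- by move=> n; exact: measurableU.
- by move=> n; exact: setUSS.
- near=> n; rewrite EFinD; apply: (le_trans (measureU2 _ _ _)) => //.
  by apply: leeD; near: n.
Unshelve. all: by end_near. Qed.

Lemma prob_leS (a : R) (E F : forall n, set (Om n)) :
  (forall n, E n `<=` F n) -> prob_le a F -> prob_le a E.
Proof.
move=> EF [N [mN FN bN]]; exists N; split => // n.
exact: subset_trans (FN n).
Qed.

Lemma prob_le_weaken (a b : R) (E : forall n, set (Om n)) :
  a <= b -> prob_le a E -> prob_le b E.
Proof.
move=> ab [N [mN EN aN]]; exists N; split => //.
by apply: filterS aN => n /le_trans; apply; rewrite lee_fin.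
Qed.

Lemma negligible_seqU (E F : forall n, set (Om n)) :
  negligible_seq E -> negligible_seq F -> negligible_seq (fun n => E n `|` F n).
Proof.
move=> nE nF eta eta0; rewrite [eta]splitr.
by apply: prob_leU; [apply: nE|apply: nF]; rewrite divr_gt0.
Qed.

Lemma negligible_seqS (E F : forall n, set (Om n)) :
  (forall n, E n `<=` F n) -> negligible_seq F -> negligible_seq E.
Proof. by move=> EF nF eta /nF; exact: prob_leS. Qed.

Lemma negligible_seq_exists M (E : nat -> forall n, set (Om n)) :
  (forall i, (i < M)%N -> negligible_seq (E i)) ->
  negligible_seq (fun n => [set w | exists2 i, (i < M)%N & E i n w]).
Proof.
elim: M => [_|M IH nE].
  move=> eta eta0; exists (fun=> set0); split => //; first by move=> n w [].
  by apply: nearW => n; rewrite measure0 lee_fin ltW.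
apply: (negligible_seqS _ (negligible_seqU (nE M _) (IH _))) => //.
  move=> n w [i]; rewrite ltnS leq_eqVlt => /orP[/eqP ->|iM]; first by left.
  by right; exists i.
by move=> i iM; apply: nE; exact: ltnW.
Qed.

(** Otherwise the covering event would be the whole space, of probability 1. An outcome avoiding all
    bad events lets a deterministic inequality pass from the graphs to the limit. *)
Lemma prob_le_inhabited (a : R) (E : forall n, set (Om n)) : a < 1 ->
  prob_le a E -> exists n (w : Om n), ~ E n w.
Proof.
move=> a1 [N [mN EN [n _ /(_ n (leqnn n))/= Na]]].
apply: contrapT => no; have NT : N n = setT.
  apply/seteqP; split => // w _; apply: EN; apply: contrapT => nE.
  by apply: no; exists n, w.
by move: Na; rewrite NT probability_setT lee_fin leNgt a1.
Qed.

Lemma cvg0_negligible (E : forall n, set (Om n)) :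
  (forall n, measurable (E n)) -> P n (E n) @[n --> \oo] --> 0%E -> negligible_seq E.
Proof.
move=> mE /fine_cvgP[fE /cvgrPdist_le cE] eta eta0; exists E; split => //; first by move=> n.
apply: filterS2 fE (cE _ eta0) => n /= fE; rewrite sub0r normrN => le.
by rewrite -[P n (E n)]fineK// lee_fin (le_trans (ler_norm _)).
Qed.

Lemma negligible_cvg0 (E : forall n, set (Om n)) :
  (forall n, measurable (E n)) -> negligible_seq E -> P n (E n) @[n --> \oo] --> 0%E.
Proof.
move=> mE nE; apply/fine_cvgP; split.
  by apply: nearW => n; exact: fin_num_measure.
apply/cvgrPdist_le => eta eta0; have [N [mN EN bN]] := nE _ eta0.
apply: filterS bN => n bN; rewrite sub0r normrN ger0_norm ?fine_ge0//.
rewrite -lee_fin fineK; last exact: fin_num_measure.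
by apply: le_trans bN; apply: le_measure; rewrite ?inE; [exact: mE|exact: mN|exact: EN].
Qed.

Variable G : forall n, Om n -> graph.

Definition cvgP_graph (Q : graph -> R) (c : R) : Prop := forall eps : R, 0 < eps ->
  negligible_seq (fun n => [set w | eps < `|Q (@G n w) - c|]).

Hypothesis Gmeas : forall n, measurable_graph (@G n).
Hypothesis Gsize : size_to_infinity P G.
Hypothesis Gui : unif_integrable_deg P G.

Lemma measurable_gmean (phi : graph -> nat -> R) (Y : set R) n :
  iso_invariant phi -> measurable [set w | Y (gmean phi (@G n w))].
Proof.
move=> inv; apply: measurable_graph_functional => // H K; first by move=> + _; exact: gmean_iso.
by move=> iH iK; rewrite !gmean_infinite.
Qed.

(** An infinite vertex set also has [scard] 0, so outside these events the graph is finite and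
    nonempty. *)
Lemma nonempty_whp : negligible_seq (fun n => [set w | scard (vert (@G n w)) = 0%N]).
Proof.
apply: (@negligible_seqS _ (fun n => [set w | (scard (vert (@G n w)) <= 0)%N])).
  by move=> n w /= ->.
apply: cvg0_negligible (Gsize 0) => n.
apply: (@measurable_graph_functional _ _ (@G n) _ (fun H => scard (vert H))
  [set k | (k <= 0)%N]) => //.
- by move=> H K [f [fb _]] _; exact: scard_bij fb.
- by move=> H K iH iK; rewrite !scard_infinite.
Qed.

Variable mu : probability local_space R.
Hypothesis Gmu : cvg_locally_in_probability P G mu.

Lemma ball_indicator_invariant i : iso_invariant (fun (H : graph) v =>
  `[< rooted_iso (gball H v 2) v (code_rgraph i) (Defs.root (code_rgraph i)) >]%:R : R).
Proof.
move=> f H K v fHK Hv; congr (_%:R); congr nat_of_bool; apply: asbool_equiv_eq.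
have [fh _ _] := fHK.1; have Kv : vert K (f v) by exact: fh.
have HK : rooted_iso (gball H v 2) v (gball K (f v) 2) (f v) by exact: gball_iso.
have KH := rooted_iso_sym (gball_root 2 Hv) HK.
by split; exact: rooted_iso_trans.
Qed.

Lemma class_freq_cvg i : cvgP_graph (class_freq R i) (class_prob mu i).
Proof.
move=> eps eps0.
have H : negligible_seq (fun n => [set w | eps <
    `|ball_freq R (code_rgraph i) 2 (@G n w) - fine (mu (ball_event 2 (code_rgraph i)))|]).
  apply: cvg0_negligible; last exact: Gmu.
  move=> n; exact: (@measurable_gmean _
    [set x | eps < `|x - fine (mu (ball_event 2 (code_rgraph i)))|] n
    (@ball_indicator_invariant i)).
apply: (negligible_seqS _ (negligible_seqU H nonempty_whp)) => n w /=.
have [fG|iG _] := pselect (finite_set (vert (G w))); last first.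
  by right; exact: scard_infinite.
rewrite class_freqE// class_probE; case: least_code; first by rewrite !mul1r; left.
by rewrite !mul0r subrr normr0 ltNge ltW.
Qed.

Lemma bounded_gmean_cvg (phi : graph -> nat -> R) (c : R) :
  iso_invariant phi -> ball2_local phi ->
  (forall G v, locally_finite G -> vert G v -> `|phi G v| <= c) ->
  cvgP_graph (gmean phi) (lmean mu phi).
Proof.
move=> inv loc phic eps eps0.
have [M [delta [delta0 HG]]] := bounded_gmean_approx mu inv loc phic eps0.
have H := @negligible_seq_exists M (fun i n =>
  [set w | delta < `|class_freq R i (@G n w) - class_prob mu i|])
  (fun i _ => class_freq_cvg i delta0).
apply: (negligible_seqS _ (negligible_seqU H nonempty_whp)) => n w /= far.
apply: contrapT => /not_orP[no /eqP G0]; move: far; apply/negP; rewrite -leNgt.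
apply: HG => // i iM; rewrite leNgt; apply/negP => ?; apply: no; by exists i.
Qed.

(** Markov's inequality, with [K] given by uniform integrability for the bound [eps * eta] on the
    expected tail. *)
Lemma degtail_prob_le (eps eta : R) : 0 < eps -> 0 < eta -> exists K,
  prob_le eta (fun n => [set w | eps < gmean (degtail R K) (@G n w)]).
Proof.
move=> eps0 eta0; have [K KP] := Gui (mulr_gt0 eps0 eta0).
have mtail (Y : set R) n := @measurable_gmean _ Y n (@degtail_invariant R K).
exists K, (fun n => [set w | eps <= gmean (degtail R K) (@G n w)]); split.
- by move=> n; apply: (mtail [set x | eps <= x]).
- by move=> n w /=; exact: ltW.
- apply: nearW => n; rewrite -(@lee_pmul2l _ eps%:E)// -EFinM.
  apply: le_trans (KP n).
  have g0 w : 0 <= gmean (degtail R K) (@G n w).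
    by apply: unif_mean_ge0 => v _; exact: degtail_ge0.
  have mg : measurable_fun setT (fun w => (gmean (degtail R K) (@G n w))%:E).
    by apply/measurable_EFinP => _ Y mY; rewrite setTI; exact: (mtail Y).
  have := @le_integral_comp_abse _ _ _ (P n) setT measurableT _ eps id _ _ _ mg eps0.
  rewrite setTI; under eq_integral do rewrite /= ger0_norm//.
  move=> h; apply: le_trans (h _ _ _) => //.
  rewrite (_ : [set x | _] = [set w | eps <= gmean (degtail R K) (G w)])//.
  by apply/seteqP; split => w /=; rewrite lee_fin ger0_norm.
Qed.

(** One [K] serves the graphs and the limit. A truncated tail is a bounded functional, so its mean
    in the graphs converges; at an outcome where the full tail is at most [eps / 2] and the
    truncated mean is within [eps / 2] of its limit, that limit is at most [eps]. *)
Lemma degtail_small (eps eta : R) : 0 < eps -> 0 < eta -> exists K,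
  prob_le eta (fun n => [set w | eps < gmean (degtail R K) (@G n w)]) /\
  forall M, lmean mu (trunc M (degtail R K)) <= eps.
Proof.
move=> eps0 eta0; have e2 : 0 < eps / 2 by rewrite divr_gt0.
have q0 : 0 < 4^-1 :> R by rewrite invr_gt0.
(* The cap 1/4 keeps the two bad events together at probability at most 1/2, so some outcome avoids
   both. *)
have m0 : 0 < Num.min eta 4^-1 by rewrite lt_min eta0.
have [K KP] := degtail_prob_le e2 m0; exists K; split.
  apply: (@prob_leS _ _ (fun n => [set w | eps / 2 < gmean (degtail R K) (@G n w)])).
    by move=> n w /=; apply: le_lt_trans; lra.
  by apply: prob_le_weaken KP; rewrite ge_min lexx.
move=> M; have bnd H v : `|trunc M (degtail R K) H v| <= 1 * M%:R.
  by apply: trunc_le => //; rewrite mul1r ger0_norm ?degtail_ge0// degtail_le.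
have C := bounded_gmean_cvg (trunc_invariant M (@degtail_invariant R K))
  (trunc_local M (@degtail_local R K)) (fun H v _ _ => bnd H v) e2 q0.
have [|n [w]] := prob_le_inhabited _ (prob_leU KP C).
  have : Num.min eta 4^-1 <= 4^-1 by rewrite ge_min lexx orbT.
  lra.
move=> /not_orP[/= /negP + /negP]; rewrite -!leNgt.
have : gmean (trunc M (degtail R K)) (G w) <= gmean (degtail R K) (G w).
  apply: le_unif_mean => v _; rewrite /trunc ler_piMr ?degtail_ge0//.
  by rewrite lern1 leq_b1.
by rewrite ler_norml => + + /andP[]; lra.
Qed.

Lemma limit_tail_bounded : exists K (b : R), forall M, lmean mu (trunc M (degtail R K)) <= b.
Proof. by have [K [_ KP]] := degtail_small ltr01 ltr01; exists K, 1. Qed.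

(** Truncating at degree [K] costs [eps / 4] in the graph and [eps / 4] in the limit, both by
    [degtail_small]; the truncation itself is bounded and contributes [eps / 2]. *)
Lemma gmean_cvg (phi : graph -> nat -> R) (c : R) : 0 < c ->
  iso_invariant phi -> ball2_local phi ->
  (forall G v, locally_finite G -> vert G v -> `|phi G v| <= c * rdeg R G v) ->
  cvgP_graph (gmean phi) (lmean mu phi).
Proof.
move=> c0 inv loc phic eps eps0 eta eta0.
have e0 : 0 < eps / 4 / c by rewrite !divr_gt0.
have e2 : 0 < eps / 2 by rewrite divr_gt0.
have eta3 : 0 < eta / 3 by rewrite divr_gt0.
have [K [KG /degtail_lmean_le[_ Kmu]]] := degtail_small e0 eta3.
have bnd H v : locally_finite H -> vert H v -> `|trunc K phi H v| <= c * K%:R.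
  by move=> lf Hv; apply: trunc_le; [exact: ltW|exact: phic].
have C := bounded_gmean_cvg (trunc_invariant K inv) (trunc_local K loc) bnd e2 eta3.
have -> : eta = eta / 3 + eta / 3 + eta / 3 by lra.
apply: (prob_leS _ (prob_leU (prob_leU KG C) (nonempty_whp eta3))) => n w /= far.
apply: contrapT => /not_orP[/not_orP[/negP + /negP]]; rewrite -!leNgt => tG tC G0.
have fG : finite_set (vert (G w)) by apply: contrapT => /scard_infinite.
have dG := gmean_truncB_le K fG phic.
have dmu := lmean_truncB_le limit_tail_bounded K (ltW c0) inv loc phic.
have ce : c * (eps / 4 / c) = eps / 4 by rewrite mulrC divfK// gt_eqF.
have {}dG := le_trans dG (ler_wpM2l (ltW c0) tG).
have {}dmu := le_trans dmu (ler_wpM2l (ltW c0) Kmu).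
rewrite ce in dG; rewrite ce in dmu.
move: far; apply/negP; rewrite -leNgt.
move: dG dmu tC; rewrite !ler_norml => /andP[? ?] /andP[? ?] /andP[? ?].
by apply/andP; split; lra.
Qed.
End Probability.

(** * Spearman's rho in terms of means *)

Section RhoFormula.
Variable R : realType.

(** The sum is extended by zero to all pairs of vertices, iterated there, and each inner sum is
    restricted again to the neighbours. *)
Lemma fsum_dedges (G : graph) (h : nat -> nat -> R) : finite_set (vert G) ->
  \sum_(e \in dedges G) h e.1 e.2 =
  \sum_(v \in vert G) \sum_(u <- fset_set (nbh G v)) h v u.
Proof.
move=> fG; have nV v : nbh G v `<=` vert G by move=> u; exact: adj_vertr.
pose H v u := h v u * (adj G v u)%:R.
transitivity (\sum_(e \in vert G `*` vert G) H e.1 e.2).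
  rewrite (eq_fsbigr (fun e => H e.1 e.2)); last first.
    by move=> e /set_mem; rewrite /dedges /H/= => ->; rewrite mulr1.
  apply: fsbig_widen => [e /= e12|e [_ /= /negP/negPf]].
    by split; [exact: adj_vert e12|exact: adj_vertr e12].
  by rewrite /H => ->; rewrite mulr0.
rewrite -(pair_fsbig _ _ fG fG); apply: eq_fsbigr => v _.
rewrite -fsbig_finite; last exact: sub_finite_set (nV v) fG.
rewrite -(@fsbig_widen _ _ 0 _ (nbh G v))//; last first.
  by move=> u [_ /= /negP/negPf]; rewrite /H /nbh/= => ->; rewrite mulr0.
by apply: eq_fsbigr => u /set_mem/=; rewrite /H /nbh/= => ->; rewrite mulr1.
Qed.

Lemma unif_mean_fsum (A : set nat) (f : nat -> R) : scard A != 0%N ->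
  \sum_(v \in A) f v = (scard A)%:R * unif_mean A f.
Proof. by move=> A0; rewrite mulrC divfK// pnatr_eq0. Qed.

Lemma scard_dedges G : scard (vert G) != 0%N ->
  (scard (dedges G))%:R = (scard (vert G))%:R * gmean (rdeg R) G.
Proof.
move=> G0; have fG : finite_set (vert G).
  by apply: contrapT => /scard_infinite; exact/eqP.
have fE : finite_set (dedges G).
  apply: (@sub_finite_set _ _ (vert G `*` vert G)); last exact: finite_setX.
  by move=> e e12; split; [exact: adj_vert e12|exact: adj_vertr e12].
rewrite -sum1_scard// (fsum_dedges (fun _ _ => 1))// -unif_mean_fsum//.
by apply: eq_fsbigr => v _; rewrite big_const_seq count_predT iter_addr_0.
Qed.

Lemma Fstar_gmean G k : scard (vert G) != 0%N ->
  Fstar R G k = gmean (trunc k (rdeg R)) G / gmean (rdeg R) G.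
Proof.
move=> G0; rewrite /Fstar scard_dedges// unif_mean_fsum//.
by rewrite -mulf_div divff ?mul1r// pnatr_eq0.
Qed.

Lemma rho_gmean (r0 : R) G : scard (vert G) != 0%N -> 0 < gmean (rdeg R) G ->
  rho r0 G = 3 * (gmean (nbh_mean (midsum (Fstar R G))) G / gmean (rdeg R) G) - 3.
Proof.
move=> G0 A0; have fG : finite_set (vert G).
  by apply: contrapT => /scard_infinite; exact/eqP.
have V0 : (scard (vert G))%:R != 0 :> R by rewrite pnatr_eq0.
rewrite /rho; case: asboolP => [_|[]]; last first.
  split => //; apply/set0P/eqP => E0.
  have : (scard (vert G))%:R * gmean (rdeg R) G = 0 :> R.
    by rewrite -scard_dedges// E0 /scard fset_set0 cardfs0.
  by move/eqP; rewrite mulf_eq0 (negPf V0) gt_eqF.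
rewrite (fsum_dedges (fun u v => midsum (Fstar R G) (deg G u) * midsum (Fstar R G) (deg G v)))//.
rewrite scard_dedges//; under eq_fsbigr do rewrite -nbh_meanE.
rewrite unif_mean_fsum// -/(gmean _ _) -mulrA [_^-1 * _]mulrC -mulf_div divff// mul1r.
by [].
Qed.

(** Mean degree 0 means that the graph is edgeless, empty or infinite by the default conventions,
    and [rho] is [r0] in each case. *)
Lemma rho_edgeless (r0 : R) G : gmean (rdeg R) G = 0 -> rho r0 G = r0.
Proof.
move=> A0; rewrite /rho; case: asboolP => // -[fG [e eE]].
have G0 : scard (vert G) != 0%N.
  rewrite scard_eq0//; apply/set0P; exists e.1; exact: adj_vert eE.
have fE : finite_set (dedges G).
  apply: (@sub_finite_set _ _ (vert G `*` vert G)); last exact: finite_setX.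
  by move=> x x12; split; [exact: adj_vert x12|exact: adj_vertr x12].
have := scard_dedges G0; rewrite A0 mulr0 => /eqP; rewrite pnatr_eq0 scard_eq0// => /eqP E0.
by move: eE; rewrite E0.
Qed.

Lemma rho_iso (r0 : R) G H : graph_iso G H -> finite_set (vert G) ->
  rho r0 G = rho r0 H.
Proof.
move=> GH fG; have [f [fb _]] := GH.
have A := gmean_iso (@rdeg_invariant R) GH.
have [A0|] := eqVneq (gmean (rdeg R) G) 0; first by rewrite !rho_edgeless// -A.
have Age0 : 0 <= gmean (rdeg R) G by apply: unif_mean_ge0.
move=> A0; have Apos : 0 < gmean (rdeg R) G by rewrite lt_neqAle eq_sym A0.
have G0 : scard (vert G) != 0%N.
  by apply: contra_neq A0 => G0; rewrite /gmean /unif_mean G0 invr0 mulr0.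
have H0 : scard (vert H) != 0%N by rewrite -(scard_bij fb).
have FE : Fstar R G = Fstar R H.
  apply/funext => k; rewrite !Fstar_gmean// A; congr (_ / _).
  by apply: gmean_iso => //; apply: trunc_invariant; exact: rdeg_invariant.
rewrite !rho_gmean// -?A// FE.
by rewrite (gmean_iso (@nbh_mean_invariant _ _) GH).
Qed.

End RhoFormula.

(** * Elementary estimates for ratios and distribution functions *)

Section Comparison.
Variable R : realType.

(** Over the common denominator [A * m] the numerator is [(B - b) * m + b * (m - A)], where
    [b <= c * m] controls the second term; [delta <= m / 2] keeps [A] above [m / 2]. *)
Lemma ratio_close (A m B b c delta : R) : 0 < m -> 0 <= c -> 0 <= b -> b <= c * m ->
  `|A - m| <= delta -> `|B - b| <= delta -> delta <= m / 2 ->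
  `|B / A - b / m| <= (1 + c) * (2 * delta / m).
Proof.
move=> m0 c0 b0 bcm Am Bb dm.
have Am2 : m / 2 <= A by move: Am; rewrite ler_norml => /andP[]; lra.
have A0 : 0 < A by lra.
have d0 : 0 <= delta by exact: le_trans (normr_ge0 _) Am.
have -> : B / A - b / m = ((B - b) * m + b * (m - A)) / (A * m).
  by rewrite -mulNr addf_div ?gt_eqF//; congr (_ / _); lra.
rewrite normrM normfV (gtr0_norm (mulr_gt0 A0 m0)) ler_pdivrMr ?mulr_gt0//.
apply: (@le_trans _ _ ((1 + c) * (delta * m))).
  apply: (le_trans (ler_normD _ _)); rewrite !normrM (gtr0_norm m0) (ger0_norm b0).
  rewrite mulrDl mul1r; apply: lerD; first by rewrite ler_wpM2r// ltW.
  by rewrite [delta * m]mulrC mulrA; apply: ler_pM => //; rewrite distrC.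
rewrite -!mulrA ler_wpM2l//; first lra.
rewrite [m^-1 * _]mulrCA mulVf ?gt_eqF// mulr1.
have : delta * (m / 2) <= delta * A by rewrite ler_wpM2l.
lra.
Qed.

(** Beyond [K] both functions are squeezed between their values at [K] and 1, and these values are
    at least [1 - a - b] and [1 - b]. *)
Lemma monotone_uniform_close (F F' : nat -> R) K a b : 0 <= b ->
  {homo F : i j / (i <= j)%N >-> i <= j} -> {homo F' : i j / (i <= j)%N >-> i <= j} ->
  (forall k, F k <= 1) -> (forall k, F' k <= 1) ->
  (forall k, (k <= K)%N -> `|F k - F' k| <= a) -> 1 - F' K <= b ->
  forall k, `|F k - F' k| <= a + b.
Proof.
move=> b0 mF mF' F1 F'1 Fa F'b k; have [kK|/ltnW Kk] := leqP k K.
  by apply: (le_trans (Fa _ kK)); rewrite lerDl.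
have := mF _ _ Kk; have := mF' _ _ Kk; have := F1 k; have := F'1 k.
have := Fa K (leqnn _); rewrite !ler_norml => /andP[? ?] ? ? ? ?.
by apply/andP; split; lra.
Qed.

Lemma midsum_ge0_le2 (F : nat -> R) k : (forall k, 0 <= F k <= 1) ->
  0 <= midsum F k <= 2.
Proof.
move=> F01; rewrite /midsum; case: k => [|k].
  by have /andP[? ?] := F01 0%N; lra.
by have /andP[? ?] := F01 k; have /andP[? ?] := F01 k.+1; lra.
Qed.

Lemma midsum_close (F F' : nat -> R) t k : 0 <= t ->
  (forall k, `|F k - F' k| <= t) -> `|midsum F k - midsum F' k| <= 2 * t.
Proof.
move=> t0 Ft; rewrite /midsum; case: k => [|k]; rewrite ler_norml.
  by have := Ft 0%N; rewrite ler_norml => /andP[? ?]; apply/andP; split; lra.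
have := Ft k; have := Ft k.+1; rewrite !ler_norml => /andP[? ?] /andP[? ?].
by apply/andP; split; lra.
Qed.

(** The difference telescopes into two products, each of a factor at most 2 and a difference at most
    [2 * t]. *)
Lemma midsumM_close (F F' : nat -> R) t j k : 0 <= t ->
  (forall k, 0 <= F k <= 1) -> (forall k, 0 <= F' k <= 1) ->
  (forall k, `|F k - F' k| <= t) ->
  `|midsum F j * midsum F k - midsum F' j * midsum F' k| <= 8 * t.
Proof.
move=> t0 F01 F'01 Ft.
have -> : midsum F j * midsum F k - midsum F' j * midsum F' k =
  (midsum F j - midsum F' j) * midsum F k + midsum F' j * (midsum F k - midsum F' k).
  by rewrite mulrBl mulrBr addrA subrK.
have /andP[a0 a2] := midsum_ge0_le2 k F01; have /andP[b0 b2] := midsum_ge0_le2 j F'01.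
apply: (le_trans (ler_normD _ _)); rewrite !normrM (ger0_norm a0) (ger0_norm b0).
have -> : 8 * t = (2 * t) * 2 + 2 * (2 * t) by lra.
by apply: lerD; apply: ler_pM => //; exact: midsum_close.
Qed.

Lemma nbh_mean_close (F F' : nat -> R) t G v : 0 <= t ->
  (forall k, 0 <= F k <= 1) -> (forall k, 0 <= F' k <= 1) ->
  (forall k, `|F k - F' k| <= t) ->
  `|nbh_mean (midsum F) G v - nbh_mean (midsum F') G v| <= 8 * t * rdeg R G v.
Proof.
move=> t0 F01 F'01 Ft; rewrite !nbh_meanE -sumrB.
by apply: ler_norm_nbh_mean => V; exact: midsumM_close.
Qed.

Lemma nbh_mean_le (F : nat -> R) G v : (forall k, 0 <= F k <= 1) ->
  0 <= nbh_mean (midsum F) G v /\ `|nbh_mean (midsum F) G v| <= 4 * rdeg R G v.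
Proof.
move=> F01; rewrite nbh_meanE; split.
  apply: sumr_ge0 => u _; have /andP[a0 _] := midsum_ge0_le2 (deg G v) F01.
  by have /andP[b0 _] := midsum_ge0_le2 (deg G u) F01; rewrite mulr_ge0.
apply: ler_norm_nbh_mean => V.
have /andP[a0 a2] := midsum_ge0_le2 (deg G v) F01.
have /andP[b0 b2] := midsum_ge0_le2 (deg G V) F01.
by rewrite ger0_norm ?mulr_ge0// (_ : 4 = 2 * 2); [exact: ler_pM|lra].
Qed.

Lemma trunc_rdeg_mono G v : {homo (fun k => trunc k (rdeg R) G v) :
  i j / (i <= j)%N >-> i <= j}.
Proof.
move=> i j ij; rewrite /trunc ler_wpM2l// ler_nat.
by case: (boolP (_ <= i)%N) => // di; rewrite (leq_trans di ij).
Qed.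

Lemma trunc_rdeg_le k G v : trunc k (rdeg R) G v <= rdeg R G v.
Proof. by rewrite /trunc ler_piMr// lern1 leq_b1. Qed.

End Comparison.

(** * The limit *)

Section LimitDistribution.
Variables (R : realType) (mu : probability local_space R).
Hypothesis mu_pos : (0 < mu [set g : clrgraph | (1 <= root_deg g)%N])%E.
Hypothesis tail_bounded :
  exists K (b : R), forall M, lmean mu (trunc M (degtail R K)) <= b.

Let int_rdeg := rdeg_integrable tail_bounded.

(** Markov's inequality at level 1: the mean degree is at least the probability of a positive
    degree. *)
Lemma lmean_rdeg_gt0 : 0 < lmean mu (rdeg R).
Proof.
rewrite -lte_fin /lmean /Rintegral fineK; last exact: (integrable_fin_num measurableT int_rdeg).
apply: (lt_le_trans mu_pos).
have := @le_integral_comp_abse _ _ _ mu setT measurableT _ 1 id _ _ _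
  (measurable_int mu int_rdeg) ltr01.
rewrite setTI mul1e => h; apply: le_trans (le_trans (h _ _ _) _) => //.
  rewrite (_ : [set g | _] = [set x | (1 <= `|(EFin \o at_root (rdeg R)) x|)%E])//.
  by apply/seteqP; split => g /=; rewrite lee_fin ger0_norm// ler1n.
by rewrite le_eqVlt; apply/orP; left; apply/eqP/eq_integral => g _ /=; rewrite ger0_norm.
Qed.

Lemma int_trunc_rdeg k : mu.-integrable setT (EFin \o at_root (trunc k (rdeg R))).
Proof.
apply: (@trunc_integrable _ _ k (rdeg R) 1) => //.
- exact: rdeg_invariant.
- exact: rdeg_local.
- by move=> G v _ _; rewrite ger0_norm// mul1r.
Qed.

Lemma Fstar_muE k : Fstar_mu mu k = lmean mu (trunc k (rdeg R)) / lmean mu (rdeg R).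
Proof. by []. Qed.

Lemma lmean_trunc_rdeg_le k : 0 <= lmean mu (trunc k (rdeg R)) <= lmean mu (rdeg R).
Proof.
apply/andP; split; first by apply: Rintegral_ge0 => g _; rewrite /at_root mulr_ge0.
apply: le_Rintegral => //; first exact: int_trunc_rdeg.
by move=> g _; exact: trunc_rdeg_le.
Qed.

Lemma Fstar_mu01 k : 0 <= Fstar_mu mu k <= 1.
Proof.
have m0 := lmean_rdeg_gt0; have /andP[? ?] := lmean_trunc_rdeg_le k.
by rewrite Fstar_muE ler_pdivrMr// mul1r divr_ge0//= ltW.
Qed.

Lemma Fstar_mu_mono : {homo Fstar_mu mu : i j / (i <= j)%N >-> i <= j}.
Proof.
move=> i j ij; rewrite !Fstar_muE ler_pM2r ?invr_gt0 ?lmean_rdeg_gt0//.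
apply: le_Rintegral => //; [exact: int_trunc_rdeg|exact: int_trunc_rdeg|].
by move=> g _; exact: trunc_rdeg_mono.
Qed.

Lemma nbh_mean_mu_bounds :
  0 <= lmean mu (nbh_mean (midsum (Fstar_mu mu))) <= 4 * lmean mu (rdeg R).
Proof.
have F01 := Fstar_mu01; apply/andP; split.
  by apply: Rintegral_ge0 => g _; rewrite /at_root (nbh_mean_le _ _ F01).1.
rewrite /lmean -RintegralZl//; apply: le_Rintegral => //.
- apply: (dominated_integrable tail_bounded (c := 4)).
  + exact: nbh_mean_invariant.
  + exact: nbh_mean_local.
  + by move=> G v _ _; exact: (nbh_mean_le _ _ F01).2.
- exact: (integrableZl measurableT 4 int_rdeg).
- by move=> g _; apply: (le_trans (ler_norm _)); exact: (nbh_mean_le _ _ F01).2.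
Qed.

Lemma rho_muE : rho_mu mu =
  3 * (lmean mu (nbh_mean (midsum (Fstar_mu mu))) / lmean mu (rdeg R)) - 3.
Proof. by rewrite /rho_mu -mulrA [_^-1 * _]mulrC. Qed.

Lemma Fstar01 (G : graph) k : scard (vert G) != 0%N -> 0 < gmean (rdeg R) G ->
  0 <= Fstar R G k <= 1.
Proof.
move=> G0 A0; rewrite Fstar_gmean// ler_pdivrMr// mul1r; apply/andP; split.
  by rewrite divr_ge0//; [apply: unif_mean_ge0 => v _; rewrite mulr_ge0|exact: ltW].
by apply: le_unif_mean => v _; exact: trunc_rdeg_le.
Qed.

Lemma Fstar_mono (G : graph) : scard (vert G) != 0%N -> 0 < gmean (rdeg R) G ->
  {homo Fstar R G : i j / (i <= j)%N >-> i <= j}.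
Proof.
move=> G0 A0 i j ij; rewrite !Fstar_gmean// ler_pM2r ?invr_gt0//.
by apply: le_unif_mean => v _; exact: trunc_rdeg_mono.
Qed.

(** The deterministic core. Replacing [Fstar] by its limit costs [8 * t], that is
    [32 * (delta / m) + 8 * gam], and the ratio of means costs [10 * (delta / m)]; the factor 3 of
    [rho] gives 126 and 24. *)
Lemma rho_close (r0 : R) (G : graph) K (delta gam : R) : scard (vert G) != 0%N ->
  delta <= lmean mu (rdeg R) / 2 -> 0 <= gam -> 1 - Fstar_mu mu K <= gam ->
  `|gmean (rdeg R) G - lmean mu (rdeg R)| <= delta ->
  (forall k, (k <= K)%N ->
    `|gmean (trunc k (rdeg R)) G - lmean mu (trunc k (rdeg R))| <= delta) ->
  `|gmean (nbh_mean (midsum (Fstar_mu mu))) G -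
    lmean mu (nbh_mean (midsum (Fstar_mu mu)))| <= delta ->
  `|rho r0 G - rho_mu mu| <= 126 * (delta / lmean mu (rdeg R)) + 24 * gam.
Proof.
move=> G0 dm gam0 FK dA dB dS; set m := lmean mu (rdeg R) in dm dA *.
set A := gmean (rdeg R) G in dA.
have m0 : 0 < m := lmean_rdeg_gt0.
have d0 : 0 <= delta by exact: le_trans (normr_ge0 _) dA.
have A0 : 0 < A by move: dA; rewrite ler_norml => /andP[]; lra.
(* The first term is [ratio_close] with [c = 1] for indices up to [K], the second the mass of the
   limit distribution beyond [K]. *)
pose t := 4 * (delta / m) + gam.
have t0 : 0 <= t by rewrite addr_ge0// mulr_ge0// divr_ge0// ltW.
have F01 k := Fstar01 k G0 A0.
have Ft k : `|Fstar R G k - Fstar_mu mu k| <= t.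
  apply: (@monotone_uniform_close _ _ _ K) => //.
  - exact: Fstar_mono.
  - exact: Fstar_mu_mono.
  - by move=> j; case/andP: (F01 j).
  - by move=> j; case/andP: (Fstar_mu01 j).
  - move=> j jK; rewrite Fstar_gmean// Fstar_muE.
    have /andP[b0 bm] := lmean_trunc_rdeg_le j.
    have := @ratio_close R A m _ _ 1 delta m0 ler01 b0 _ dA (dB _ jK) dm.
    rewrite mul1r => /(_ bm) h; apply: (le_trans h); lra.
have /andP[s0 sm] := nbh_mean_mu_bounds.
(* Here [c] is 4 because each [midsum] is at most 2. *)
have SA := @ratio_close R A m _ _ 4 delta m0 (ler0n _ _) s0 sm dA dS dm.
set s := lmean mu (nbh_mean _) in SA; set S := gmean (nbh_mean _) G in SA.
pose T := gmean (nbh_mean (midsum (Fstar R G))) G.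
have TS : `|T / A - S / A| <= 8 * t.
  rewrite -mulrBl normrM normfV (gtr0_norm A0) ler_pdivrMr// /T /S /A.
  rewrite /gmean -unif_meanB -unif_meanZ.
  apply: (le_trans (ler_norm_unif_mean _ _)); apply: le_unif_mean => v _.
  exact: nbh_mean_close F01 Fstar_mu01 Ft.
rewrite rho_gmean// rho_muE -/m -/A -/T -/s.
move: TS SA; rewrite /t !ler_norml => /andP[? ?] /andP[? ?].
by apply/andP; split; lra.
Qed.

End LimitDistribution.

Theorem theorem2p3 (R : realType)
  (d : nat -> measure_display) (Om : forall n, measurableType (d n))
  (P : forall n, probability (Om n) R)
  (G : forall n, Om n -> graph)
  (Gmeas : forall n, measurable_graph (@G n))
  (Gfin : forall n, {ae P n, forall w, finite_set (vert (@G n w))})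
  (Gsize : size_to_infinity P G)
  (Gui : unif_integrable_deg P G)
  (mu : probability local_space R)
  (mu_pos : (0 < mu [set g : clrgraph | (1 <= root_deg g)%N])%E)
  (Gmu : cvg_locally_in_probability P G mu)
  (r0 : R) :
  cvg_in_probability P (fun n w => rho r0 (@G n w)) (rho_mu mu).
Proof.
move=> eps eps0.
have tb := limit_tail_bounded Gmeas Gsize Gui Gmu.
have m0 := lmean_rdeg_gt0 mu_pos tb; set m := lmean mu (rdeg R) in m0.
have F01 := Fstar_mu01 mu_pos tb.
apply: negligible_cvg0.
  move=> n; apply: (@measurable_graph_functional _ _ (@G n) _ (rho r0)
    [set x | eps < `|x - rho_mu mu|]) => //.
    by move=> H K HK fH; exact: rho_iso.
  by move=> H K iH iK; rewrite /rho; do 2 (case: asboolP => [[]//|_]).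
(* With these choices [24 * gam] and [126 * (delta / m)] are each at most [eps / 2]; the bound
   [m / 2] on [delta] is what [ratio_close] requires. *)
pose gam := eps / 48; have gam0 : 0 < gam by rewrite divr_gt0.
pose delta := Num.min (m / 2) (eps * m / 252).
have delta0 : 0 < delta by rewrite lt_min !divr_gt0// mulr_gt0.
have dm : delta <= m / 2 by rewrite ge_min lexx.
have de : delta / m <= eps / 252.
  by rewrite ler_pdivrMr// mulrAC ge_min lexx orbT.
(* The mass [1 - Fstar_mu mu K] is the mean degree lost by truncating at [K], divided by [m], and
   the degree tail bounds this loss by [gam * m]. *)
have [K FK] : exists K, 1 - Fstar_mu mu K <= gam.
  have [K [_ /degtail_lmean_le[_ tK]]] :=
    degtail_small Gmeas Gsize Gui Gmu (mulr_gt0 gam0 m0) ltr01.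
  exists K; have := @lmean_truncB_le _ _ tb K (rdeg R) 1 ler01
    (@rdeg_invariant R) (@rdeg_local R).
  rewrite mul1r => h; have {h} : `|m - lmean mu (trunc K (rdeg R))| <= lmean mu (degtail R K).
    by apply: h => H v _ _; rewrite ger0_norm// mul1r.
  move=> /(le_trans (ler_norm _))/le_trans/(_ tK) h.
  by rewrite Fstar_muE -/m -[1](divff (lt0r_neq0 m0)) -mulrBl ler_pdivrMr.
have dcvg := gmean_cvg Gmeas Gsize Gui Gmu ltr01.
have rb H v : `|rdeg R H v| <= 1 * rdeg R H v by rewrite ger0_norm// mul1r.
have cA := dcvg (rdeg R) (@rdeg_invariant R) (@rdeg_local R) (fun H v _ _ => rb H v) _ delta0.
have cB k : cvgP_graph P G (gmean (trunc k (rdeg R))) (lmean mu (trunc k (rdeg R))).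
  apply: dcvg; [exact/trunc_invariant/rdeg_invariant|exact/trunc_local/rdeg_local|].
  move=> H v _ _; rewrite ger0_norm ?mul1r; [exact: trunc_rdeg_le|by rewrite mulr_ge0].
have cBK := @negligible_seq_exists _ _ _ P K.+1 (fun k n => [set w | delta <
    `|gmean (trunc k (rdeg R)) (@G n w) - lmean mu (trunc k (rdeg R))|])
  (fun k _ => cB k _ delta0).
have cS : cvgP_graph P G (gmean (nbh_mean (midsum (Fstar_mu mu))))
    (lmean mu (nbh_mean (midsum (Fstar_mu mu)))).
  apply: (gmean_cvg Gmeas Gsize Gui Gmu (c := 4)) => //.
  - exact: nbh_mean_invariant.
  - exact: nbh_mean_local.
  - by move=> H v _ _; exact: (nbh_mean_le _ _ F01).2.
(* Outside these events every hypothesis of [rho_close] holds, so a deviation above [eps] forces one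
   of them. *)
have bad := negligible_seqU (negligible_seqU cA cBK)
  (negligible_seqU (cS _ delta0) (nonempty_whp Gmeas Gsize)).
apply: (negligible_seqS _ bad) => n w /= far; apply: contrapT => /not_orP[].
move=> /not_orP[/negP + nB] /not_orP[/negP + /eqP G0]; rewrite -!leNgt => hA hS.
move: far; apply/negP; rewrite -leNgt.
have hB k : (k <= K)%N -> `|gmean (trunc k (rdeg R)) (@G n w) - lmean mu (trunc k (rdeg R))| <= delta.
  by move=> kK; rewrite leNgt; apply/negP => ?; apply: nB; exists k.
apply: (le_trans (rho_close mu_pos tb r0 G0 dm (ltW gam0) FK hA hB hS)).
by rewrite -/m /gam; lra.
Qed.
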